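(* Let $X$ be a locally Noetherian scheme over a field $k$ of characteristic zero and let $\mathscr{F}$ be a locally free foliation on $X$ over $k$. Then, for any closed point $x \in X$, the formal leaf of $\mathscr{F}$ through $x$ is regular.
   Context: A foliation $\mathscr{F}$ on $X$ over $k$ is a coherent subsheaf $\mathscr{F} \subseteq \mathscr{T}_{X/k}$ of the tangent sheaf (sheaf of $k$-derivations of $\mathscr{O}_X$) which is closed under the Lie bracket. It need not be saturated. It is locally free if $\mathscr{F}$ is a locally free $\mathscr{O}_X$-module of finite rank. Formal leaf: let $x\in X$ be a closed point and let $\hat A$ be the completion of $\mathscr{O}_{X,x}$ at its maximal ideal, with maximal ideal $\hat{\mathfrak m}$. Every derivation in the stalk $\mathscr{F}_x$ extends uniquely to a continuous $k$-derivation of $\hat A$. An ideal $K \subseteq \hat A$ is $\mathscr{F}$-invariant if $\partial(K)\subseteq K$ for all $\partial \in \mathscr{F}_x$. The formal leaf $L$ of $\mathscr{F}$ through $x$ is the minimal non-empty $\mathscr{F}$-invariant closed formal subscheme of $\mathrm{Spf}\,\hat A$, that is, $L=\mathrm{Spf}(\hat A/K)$ where $K$ is the largest $\mathscr{F}$-invariant ideal contained in $\hat{\mathfrak m}$. The formal leaf is regular if $\hat A/K$ is a regular local ring. *)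

(* Defs.v *)
From HB Require Import structures.
From mathcomp Require Import all_boot all_algebra.
From mathcomp Require Import boolp classical_sets functions topology.

Set Implicit Arguments.
Unset Strict Implicit.
Unset Printing Implicit Defensive.

Import GRing.Theory.
Local Open Scope classical_set_scope.
Local Open Scope ring_scope.

(* Ideals are classical sets and rings may be zero (the sections over the empty
   open set form the zero ring), whereas MathComp's [idealr] and [prime_idealr]
   are boolean predicates, proper by definition, on nonzero rings. *)

Definition is_ideal (A : comPzRingType) (I : set A) : Prop :=
  [/\ I 0, (forall a b, I a -> I b -> I (a + b)) & forall a b, I b -> I (a * b)].

Definition ideal_gen (A : comPzRingType) (S : set A) : set A :=
  smallest (@is_ideal A) S.

(* For n = 0 the only generator is the empty product 1, so I^0 = A. *)
Definition ideal_pow (A : comPzRingType) (I : set A) (n : nat) : set A :=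
  ideal_gen [set p | exists2 f : 'I_n -> A,
    (forall i, I (f i)) & p = \prod_(i < n) f i].

Definition prime_ideal (A : comPzRingType) (P : set A) : Prop :=
  [/\ is_ideal P, ~ P 1 & forall a b, P (a * b) -> P a \/ P b].

Definition maximal_ideal (A : comPzRingType) (M : set A) : Prop :=
  [/\ is_ideal M, ~ M 1 &
      forall J, is_ideal J -> M `<=` J -> J = M \/ J = setT].

Definition noetherian (A : comPzRingType) : Prop :=
  forall I : set A, is_ideal I -> exists s : seq A, I = ideal_gen [set` s].

Definition prime_chain (A : comPzRingType) (n : nat) : Prop :=
  exists P : 'I_n.+1 -> set A,
    (forall i, prime_ideal (P i)) /\
    (forall i j : 'I_n.+1, (i < j)%N -> P i `<` P j).

Definition krull_dim_eq (A : comPzRingType) (n : nat) : Prop :=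
  prime_chain A n /\ forall m, prime_chain A m -> (m <= n)%N.

Definition regular_local_ring (A : comPzRingType) : Prop :=
  noetherian A /\
  exists2 M : set A,
    maximal_ideal M /\ (forall M', maximal_ideal M' -> M' = M) &
    exists2 n, krull_dim_eq A n &
      exists s : n.-tuple A, M = ideal_gen [set` tval s].

(* f exhibits B as the localization A_a of A at the powers of a. *)
Definition is_localization_away (A B : comPzRingType) (a : A) (f : A -> B) :=
  [/\ (exists c, f a * c = 1),
      (forall b, exists n a', b * f a ^+ n = f a') &
      (forall a1 a2, f a1 = f a2 -> exists n, a ^+ n * a1 = a ^+ n * a2)].

(* A model of the quotient ring A/K, with its projection. *)
Record quotient (A : comPzRingType) (K : set A) := Quotient {
  quot_ring :> comPzRingType;
  quot_map : {rmorphism A -> quot_ring};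
  quot_surj : forall b, exists a, quot_map a = b;
  quot_ker : forall a, quot_map a = 0 <-> K a }.

(* A model of the I-adic completion lim_n A/I^n.  The limit is presented by the
   kernels [cpl_ker n] of its projections to A/I^n: by [cpl_dense] and
   [cpl_kerE] its quotient by [cpl_ker n] is A/I^n, by [cpl_decr] these
   projections are compatible, and by [cpl_sep] and [cpl_lim] they identify it
   with the set of compatible sequences (u_n mod I^n).  The sets [cpl_ker n] are
   a base of neighbourhoods of 0 for the limit topology. *)
Record completion (A : comPzRingType) (I : set A) := Completion {
  cpl_ring :> comPzRingType;
  cpl_map : {rmorphism A -> cpl_ring};
  cpl_ker : nat -> set cpl_ring;
  cpl_ker_ideal : forall n, is_ideal (cpl_ker n);
  cpl_decr : forall n, cpl_ker n.+1 `<=` cpl_ker n;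
  cpl_dense : forall n b, exists a, cpl_ker n (b - cpl_map a);
  cpl_kerE : forall n a, cpl_ker n (cpl_map a) <-> ideal_pow I n a;
  cpl_sep : forall b, (forall n, cpl_ker n b) -> b = 0;
  cpl_lim : forall u : nat -> A, (forall n, ideal_pow I n (u n.+1 - u n)) ->
    exists b, forall n, cpl_ker n (b - cpl_map (u n)) }.

Arguments cpl_map {A I}.
Arguments cpl_ker {A I}.

(* D is a derivation of A, linear over k along the ring map f : k -> A. *)
Definition is_derivation (k : fieldType) (A : comPzRingType) (f : k -> A)
    (D : A -> A) : Prop :=
  [/\ (forall a b, D (a + b) = D a + D b),
      (forall a b, D (a * b) = a * D b + b * D a) &
      (forall c a, D (f c * a) = f c * D a)].

Record opens (T : topologicalType) := Opens {
  oset :> set T;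
  oset_open : open oset }.

Definition full_open (T : topologicalType) : opens T := Opens (@openT T).

Record ringed_space := RingedSpace {
  points :> topologicalType;
  sheaf : opens points -> comPzRingType;
  res : forall U V : opens points, V `<=` U -> {rmorphism sheaf U -> sheaf V};
  res_id : forall (U : opens points) (h : U `<=` U) (s : sheaf U), res h s = s;
  res_comp : forall (U V W : opens points)
      (hVU : V `<=` U) (hWV : W `<=` V) (hWU : W `<=` U) (s : sheaf U),
    res hWV (res hVU s) = res hWU s;
  sheaf_glue : forall (U : opens points) (I : Type) (V : I -> opens points)
      (hV : forall i, V i `<=` U), U `<=` \bigcup_i V i ->
    forall s : forall i, sheaf (V i),
      (forall i j (W : opens points) (hi : W `<=` V i) (hj : W `<=` V j),
        res hi (s i) = res hj (s j)) ->
    exists! t : sheaf U, forall i, res (hV i) t = s i }.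

Arguments sheaf : clear implicits.
Arguments res {r U V}.

(* An isomorphism of the open subspace U of X with Spec A.  [chart_bij] and
   [chart_top] are a homeomorphism onto the set of primes of A with the Zariski
   topology.  As the structure sheaf of Spec A is the sheaf whose sections over
   the basic open set D(a) are A_a, [chart_sec] is the isomorphism of sheaves. *)
Record affine_chart (X : ringed_space) (U : opens X) (A : comPzRingType) :=
  AffineChart {
  chart_prime : X -> set A;
  chart_map : {rmorphism A -> sheaf X U};
  chart_bij : set_bij (oset U) [set P | prime_ideal P] chart_prime;
  chart_top : forall W : set X, W `<=` U ->
    (open W <-> exists S : set A,
      W = [set x | oset U x /\ exists2 a, S a & ~ chart_prime x a]);
  chart_sec : forall (a : A) (V : opens X) (hV : V `<=` U),
    oset V = [set x | oset U x /\ ~ chart_prime x a] ->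
    is_localization_away a (fun b => res hV (chart_map b)) }.

Record scheme := Scheme {
  scheme_space :> ringed_space;
  scheme_affine : forall x : scheme_space,
    exists2 U : opens scheme_space, oset U x &
    exists A : comPzRingType, inhabited (affine_chart U A) }.

Definition locally_noetherian (X : scheme) : Prop :=
  forall x : X, exists2 U : opens X, oset U x &
    exists2 A : comPzRingType, noetherian A & inhabited (affine_chart U A).

(* A morphism X -> Spec k is a ring map k -> O_X(X). *)
Record scheme_over (k : fieldType) := SchemeOver {
  over_scheme :> scheme;
  over_map : {rmorphism k -> sheaf over_scheme (full_open over_scheme)} }.

Definition kconst (k : fieldType) (X : scheme_over k) (U : opens X) (c : k) :
  sheaf X U := res (U := full_open X) (@subsetT X U) (over_map X c).

(* A model of the local ring O_{X,x}, the colimit of O_X(U) over U containing x. *)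
Record stalk (X : ringed_space) (x : X) := Stalk {
  stalk_ring :> comPzRingType;
  germ : forall U : opens X, oset U x -> {rmorphism sheaf X U -> stalk_ring};
  germ_res : forall (U V : opens X) (hVU : V `<=` U)
      (hU : oset U x) (hV : oset V x) (s : sheaf X U),
    germ hV (res hVU s) = germ hU s;
  germ_surj : forall a, exists U (hU : oset U x) (s : sheaf X U), germ hU s = a;
  germ_eq : forall (U : opens X) (hU : oset U x) (s t : sheaf X U),
    germ hU s = germ hU t ->
    exists (V : opens X) (hVU : V `<=` U), oset V x /\ res hVU s = res hVU t }.

Arguments germ {X x} _ {U}.

(* Families of self-maps of O_X(V) for V in U; the sections over U of the
   tangent sheaf are those satisfying [tangent]. *)
Definition vfield (X : ringed_space) (U : opens X) : Type :=
  forall V : opens X, V `<=` U -> sheaf X V -> sheaf X V.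

Definition tangent (k : fieldType) (X : scheme_over k) (U : opens X) :
    set (vfield U) :=
  [set D | (forall (V : opens X) (hV : V `<=` U),
              is_derivation (kconst V) (D V hV)) /\
           (forall (V W : opens X) (hV : V `<=` U) (hW : W `<=` U)
              (hWV : W `<=` V) (s : sheaf X V),
              res hWV (D V hV s) = D W hW (res hWV s))].

Section VectorFields.
Variable X : ringed_space.
Implicit Types U V W : opens X.

Definition vres U V (hVU : V `<=` U) (D : vfield U) : vfield V :=
  fun W hW => D W (subset_trans hW hVU).

Definition vzero U : vfield U := fun V hV s => 0.

Definition vadd U (D E : vfield U) : vfield U :=
  fun V hV s => D V hV s + E V hV s.

Definition vscale U (a : sheaf X U) (D : vfield U) : vfield U :=
  fun V hV s => res hV a * D V hV s.

Definition vbracket U (D E : vfield U) : vfield U :=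
  fun V hV s => D V hV (E V hV s) - E V hV (D V hV s).

Definition vcomb U n (a : 'I_n -> sheaf X U) (e : 'I_n -> vfield U) : vfield U :=
  fun V hV s => \sum_(i < n) res hV (a i) * e i V hV s.

Variable F : forall U, set (vfield U).

Definition finite_type : Prop :=
  forall x : X, exists2 U, oset U x &
  exists n (e : 'I_n -> vfield U), (forall i, F (e i)) /\
  forall V (hV : V `<=` U) (D : vfield V), F D ->
  forall y, oset V y -> exists W (hW : W `<=` V), oset W y /\
  exists a : 'I_n -> sheaf X W,
    vres hW D = vcomb a (fun i => vres hW (vres hV (e i))).

(* The kernel of every map O_U^n -> F|_U is of finite type. *)
Definition finite_relations : Prop :=
  forall U n (e : 'I_n -> vfield U), (forall i, F (e i)) ->
  forall x, oset U x -> exists V (hV : V `<=` U), oset V x /\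
  exists m (r : 'I_m -> 'I_n -> sheaf X V),
    (forall j, vcomb (r j) (fun i => vres hV (e i)) = vzero (U := V)) /\
    forall W (hW : W `<=` V) (b : 'I_n -> sheaf X W),
    vcomb b (fun i => vres hW (vres hV (e i))) = vzero (U := W) ->
    forall y, oset W y -> exists W' (hW' : W' `<=` W), oset W' y /\
    exists c : 'I_m -> sheaf X W',
      forall i, res hW' (b i) = \sum_(j < m) c j * res hW' (res hW (r j i)).

Definition coherent : Prop := finite_type /\ finite_relations.

(* Locally on X there is an isomorphism O_U^n -> F|_U. *)
Definition locally_free : Prop :=
  forall x : X, exists2 U, oset U x &
  exists n (e : 'I_n -> vfield U), (forall i, F (e i)) /\
  forall V (hV : V `<=` U) (D : vfield V), F D ->
    exists! a : 'I_n -> sheaf X V, D = vcomb a (fun i => vres hV (e i)).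

End VectorFields.

Record foliation (k : fieldType) (X : scheme_over k) := Foliation {
  fol :> forall U : opens X, set (vfield U);
  fol_tangent : forall U, @fol U `<=` @tangent k X U;
  fol_zero : forall U, @fol U (vzero (U := U));
  fol_add : forall U D E, @fol U D -> @fol U E -> @fol U (vadd D E);
  fol_scale : forall U a D, @fol U D -> @fol U (vscale a D);
  fol_res : forall (U V : opens X) (hV : V `<=` U) D,
    @fol U D -> @fol V (vres hV D);
  fol_local : forall U D, @tangent k X U D ->
    (forall x, oset U x -> exists (V : opens X) (hV : V `<=` U),
      oset V x /\ @fol V (vres hV D)) -> @fol U D;
  fol_coherent : coherent fol;
  fol_bracket : forall U D E, @fol U D -> @fol U E -> @fol U (vbracket D E) }.

Section FormalLeaf.
Variables (k : fieldType) (X : scheme_over k) (F : foliation X) (x : X).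
Variables (Ox : stalk x) (m : set Ox) (Ah : completion m).

Definition completed_const (c : k) : Ah :=
  cpl_map Ah (germ Ox (U := full_open X) I (over_map X c)).

(* An element of the stalk F_x is given as the germ at x of a section D of F
   over U.  Continuity at 0 suffices, as d is additive. *)
Definition extends_stalk (d : Ah -> Ah) : Prop :=
  [/\ is_derivation completed_const d,
      (forall n, exists N, d @` cpl_ker Ah N `<=` cpl_ker Ah n) &
      exists (U : opens X) (D : vfield U), [/\ oset U x, F U D &
        forall (V : opens X) (hV : V `<=` U) (hx : oset V x) (s : sheaf X V),
          d (cpl_map Ah (germ Ox hx s)) = cpl_map Ah (germ Ox hx (D V hV s))]].

Definition invariant_ideal (K : set Ah) : Prop :=
  is_ideal K /\ forall d, extends_stalk d -> d @` K `<=` K.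

(* The largest invariant ideal K in mh defines the smallest nonempty invariant
   closed formal subscheme Spf (Ah/K). *)
Definition leaf_ideal (mh K : set Ah) : Prop :=
  [/\ invariant_ideal K, K `<=` mh &
      forall J, invariant_ideal J -> J `<=` mh -> J `<=` K].

End FormalLeaf.

(* Main.v *)
(* Write B for the completed local ring modulo the leaf ideal K.  By maximality
   of K, the ring B has no proper nonzero ideal stable under all derivations, and
   K is closed, because its closure is invariant too; so B is a complete local
   ring with finitely generated maximal ideal M.  If M <> 0, then M is not
   invariant, so some derivation D takes the value 1 on a member x of a given
   finite set of generators.  Zariski's lemma then gives B = S[[x]] with S the
   ring of constants of D, which is again differentially simple and whose maximal
   ideal needs one generator fewer.  By induction B is a Noetherian domain, and it
   has a chain of primes as long as some generating set of M.  For the upper bound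
   on the dimension, given f <> 0 in M, polarization yields a D with D^d f a unit
   for some d; so f is regular in x, by Weierstrass division B/f is finite over S,
   and the primes of B containing f contract injectively to S along chains. *)
From HB Require Import structures.
Require Import Defs.
From mathcomp Require Import all_boot all_algebra.
From mathcomp Require Import boolp classical_sets functions topology.
From mathcomp Require Import ring.

Set Implicit Arguments.
Unset Strict Implicit.
Unset Printing Implicit Defensive.

Import GRing.Theory.
Local Open Scope classical_set_scope.
Local Open Scope ring_scope.

(** * Ideals and their powers *)

Section Ideals.
Variable A : comPzRingType.
Implicit Types (I J M : set A) (a b c : A) (s : seq A).

Lemma ideal0 I : is_ideal I -> I 0. Proof. by case. Qed.
Lemma idealD I a b : is_ideal I -> I a -> I b -> I (a + b).
Proof. by case=> _ h _; apply: h. Qed.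
Lemma ideal_mull I a b : is_ideal I -> I b -> I (a * b).
Proof. by case=> _ _; apply. Qed.
Lemma ideal_mulr I a b : is_ideal I -> I a -> I (a * b).
Proof. by rewrite mulrC; exact: ideal_mull. Qed.
Lemma idealN I a : is_ideal I -> I a -> I (- a).
Proof. by rewrite -mulN1r; exact: ideal_mull. Qed.
Lemma idealB I a b : is_ideal I -> I a -> I b -> I (a - b).
Proof. by move=> hI Ia Ib; apply: idealD => //; exact: idealN. Qed.
Lemma ideal_sum I (T : Type) (r : seq T) (P : pred T) (f : T -> A) :
  is_ideal I -> (forall i, P i -> I (f i)) -> I (\sum_(i <- r | P i) f i).
Proof.
move=> hI h; elim/big_ind: _ => //; first exact: ideal0.
by move=> *; exact: idealD.
Qed.
Lemma ideal_subl I a b : is_ideal I -> I (a - b) -> (I a <-> I b).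
Proof.
move=> hI Iab; split=> h; last by rewrite -(subrK b a); exact: idealD.
by rewrite -(subKr a b); exact: idealB.
Qed.
Lemma ideal_swap I a b : is_ideal I -> I (a - b) -> I (b - a).
Proof. by move=> hI h; rewrite -opprB; exact: idealN. Qed.
Lemma ideal_trans I a b c : is_ideal I -> I (a - b) -> I (b - c) -> I (a - c).
Proof. by move=> hI h1 h2; rewrite -(subrKA b); exact: idealD. Qed.

Lemma ideal_gen_ideal (S : set A) : is_ideal (ideal_gen S).
Proof.
split=> [J [hJ _]|a b ha hb J JS|a b hb J JS].
- exact: ideal0.
- by apply: idealD (ha _ JS) (hb _ JS); case: JS.
- by apply: ideal_mull (hb _ JS); case: JS.
Qed.

Lemma sub_ideal_gen (S : set A) : S `<=` ideal_gen S.
Proof. by move=> a Sa J [_]; apply. Qed.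

Lemma ideal_gen_min (S I : set A) : is_ideal I -> S `<=` I -> ideal_gen S `<=` I.
Proof. by move=> hI SI a; apply. Qed.

Lemma setT_ideal : is_ideal [set: A].
Proof. by []. Qed.

Lemma ideal_eqT I : is_ideal I -> I 1 -> I = setT.
Proof.
by move=> hI I1; apply/seteqP; split=> // a _; rewrite -(mulr1 a); apply: ideal_mull.
Qed.

Definition lcomb s (c : nat -> A) : A := \sum_(i < size s) c i * s`_i.

Lemma lcombP s : ideal_gen [set` s] = range (lcomb s).
Proof.
apply/seteqP; split.
  apply: ideal_gen_min; first split.
  - exists (fun=> 0) => //; rewrite /lcomb big1 // => i _; exact: mul0r.
  - move=> _ _ [c _ <-] [d _ <-]; exists (c \+ d) => //.
    by rewrite /lcomb -big_split; apply: eq_bigr => i _; rewrite mulrDl.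
  - move=> a _ [c _ <-]; exists (fun i => a * c i) => //.
    by rewrite /lcomb mulr_sumr; apply: eq_bigr => i _; rewrite mulrA.
  move=> a /= /(nthP 0)[i ilt <-]; exists (fun j => (j == i)%:R) => //.
  rewrite /lcomb (bigD1 (Ordinal ilt)) //= eqxx mul1r big1 ?addr0 // => j.
  by rewrite -val_eqE /= => /negPf->; rewrite mul0r.
move=> _ [c _ <-]; apply: ideal_sum => [|i _]; first exact: ideal_gen_ideal.
by apply: ideal_mull (ideal_gen_ideal _) _; apply: sub_ideal_gen; exact: mem_nth.
Qed.

Lemma lcomb_gen s (c : nat -> A) : ideal_gen [set` s] (lcomb s c).
Proof. by rewrite lcombP; exists c. Qed.

(* The defining set of generators of [ideal_pow] is awkward for inductions. *)
Fixpoint mpow M n : set A :=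
  if n is n'.+1 then
    ideal_gen [set p | exists a b, [/\ M a, mpow M n' b & p = a * b]]
  else setT.

Lemma mpow_ideal M n : is_ideal (mpow M n).
Proof. by case: n => [|n]; [exact: setT_ideal|exact: ideal_gen_ideal]. Qed.

Lemma mpow0 M n : mpow M n 0.
Proof. exact: ideal0 (mpow_ideal _ _). Qed.
Lemma mpowD M n a b : mpow M n a -> mpow M n b -> mpow M n (a + b).
Proof. exact: idealD (mpow_ideal _ _). Qed.
Lemma mpowMl M n a b : mpow M n b -> mpow M n (a * b).
Proof. exact: ideal_mull (mpow_ideal _ _). Qed.

Lemma mpowS M n a b : M a -> mpow M n b -> mpow M n.+1 (a * b).
Proof. by move=> Ma Mb; apply: sub_ideal_gen; exists a, b. Qed.

Lemma mpowS_min M n I : is_ideal I ->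
  (forall a b, M a -> mpow M n b -> I (a * b)) -> mpow M n.+1 `<=` I.
Proof. by move=> hI h; apply: ideal_gen_min => // _ [a [b [? ? ->]]]; apply: h. Qed.

Lemma mpow_decr M n : mpow M n.+1 `<=` mpow M n.
Proof.
apply: mpowS_min => [|a b _]; first exact: mpow_ideal.
exact: mpowMl.
Qed.

Lemma mpow1 M : is_ideal M -> mpow M 1 = M.
Proof.
move=> hM; apply/seteqP; split; first by apply: mpowS_min => // *; exact: ideal_mulr.
by move=> a Ma; rewrite -(mulr1 a); apply: mpowS.
Qed.

Lemma mpow_mul M n p a b : mpow M n a -> mpow M p b -> mpow M (n + p) (a * b).
Proof.
elim: n a b => [|n IH] a b; first by move=> _; exact: mpowMl.
move=> Ma Mb; move: a Ma; apply: mpowS_min => [|a c Ma Mc].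
  split=> [|a c ha hc|a c hc]; [rewrite mul0r|rewrite mulrDl|rewrite -mulrA].
  - exact: mpow0.
  - exact: mpowD ha hc.
  - exact: mpowMl hc.
by rewrite -mulrA addSn; apply: mpowS => //; apply: IH.
Qed.

Lemma mpow_exp M x n : M x -> mpow M n (x ^+ n).
Proof. by move=> Mx; elim: n => [//|n IH]; rewrite exprS; apply: mpowS. Qed.

Lemma ideal_powE M n : is_ideal M -> ideal_pow M n = mpow M n.
Proof.
move=> hM; apply/seteqP; split.
  apply: ideal_gen_min => [|_ [f Mf ->]]; first exact: mpow_ideal.
  elim: n f Mf => [//|n IH] f Mf; rewrite big_ord_recl.
  by apply: mpowS => //; apply: IH.
elim: n => [a _|n IH].
  rewrite -(mulr1 a); apply: ideal_mull (ideal_gen_ideal _) _; apply: sub_ideal_gen.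
  by exists (fun=> 0); rewrite ?big_ord0 // => -[].
apply: mpowS_min => [|a b Ma /IH]; first exact: ideal_gen_ideal.
(* For fixed [a] the elements whose product with [a] lies in the next power form an ideal, so it
   suffices to treat the products of [n] members of [M]. *)
suff: ideal_pow M n `<=` [set b | ideal_pow M n.+1 (a * b)] by apply.
apply: ideal_gen_min => [|_ [f Mf ->]].
  split=> [|c d hc hd|c d hd] /=; [rewrite mulr0|rewrite mulrDr|rewrite mulrCA].
  - exact: ideal0 (ideal_gen_ideal _).
  - exact: idealD (ideal_gen_ideal _) hc hd.
  - exact: ideal_mull (ideal_gen_ideal _) hd.
apply: sub_ideal_gen; exists (fun i => oapp f a (unlift ord0 i)).
  by move=> i; case: unliftP => [j|] _ /=.
rewrite big_ord_recl unlift_none; congr (_ * _).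
by apply: eq_bigr => i _; rewrite liftK.
Qed.

(** Keeping the coefficients in the n-th power is what makes the successive corrections in
    [cpl_ker_gen] converge. *)
Lemma mpowS_gen M s n a : M = ideal_gen [set` s] -> mpow M n.+1 a ->
  exists2 c : nat -> A, (forall i, mpow M n (c i)) & a = lcomb s c.
Proof.
move=> Ms; move: a; apply: mpowS_min => [|a b].
  split=> [|_ _ [c Mc ->] [d Md ->]|a _ [c Mc ->]].
  - exists (fun=> 0) => [_|]; first exact: mpow0.
    by rewrite /lcomb big1 // => i _; rewrite mul0r.
  - exists (fun i => c i + d i) => [i|]; first exact: mpowD (Mc i) (Md i).
    by rewrite /lcomb -big_split; apply: eq_bigr => i _; rewrite mulrDl.
  - exists (fun i => a * c i) => [i|]; first exact: mpowMl (Mc i).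
    by rewrite /lcomb mulr_sumr; apply: eq_bigr => i _; rewrite mulrA.
rewrite {1}Ms lcombP => -[c _ <-] Mb; exists (fun i => c i * b) => [i|].
  exact: mpowMl Mb.
by rewrite /lcomb mulr_suml; apply: eq_bigr => i _; rewrite mulrAC.
Qed.

End Ideals.

Arguments mpow : simpl never.
Arguments ideal_mull {A I a b}.
Arguments ideal_mulr {A I a b}.
Arguments mpowMl {A M n a b}.
Arguments ideal_sum {A I T r P f}.
Arguments lcomb_gen {A} s c.

Section Image.
Variables (A B : comPzRingType) (f : {rmorphism A -> B}).
Hypothesis f_surj : forall b, exists a, f a = b.

Lemma image_ideal (I : set A) : is_ideal I -> is_ideal (f @` I).
Proof.
move=> hI; split=> [|_ _ [a Ia <-] [b Ib <-]|b _ [a Ia <-]].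
- by exists 0; [exact: ideal0|rewrite rmorph0].
- by exists (a + b); [exact: idealD|rewrite rmorphD].
- by have [c <-] := f_surj b; exists (c * a); [exact: ideal_mull|rewrite rmorphM].
Qed.

Lemma image_lcomb s c : f (lcomb s c) = lcomb (map f s) (f \o c).
Proof.
rewrite /lcomb rmorph_sum size_map; apply: eq_bigr => i _.
by rewrite rmorphM (nth_map 0).
Qed.

Lemma image_ideal_gen (s : seq A) :
  f @` ideal_gen [set` s] = ideal_gen [set` map f s].
Proof.
apply/seteqP; split=> [_ [a + <-]|b].
  by rewrite lcombP => -[c _ <-]; rewrite image_lcomb; exact: lcomb_gen.
rewrite (lcombP (map f s)) => -[c _ <-].
have /choice[d dP] : forall i, exists a, f a = c i by [].
exists (lcomb s d); first exact: lcomb_gen.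
by rewrite image_lcomb; congr lcomb; apply/funext => i; exact: dP.
Qed.

End Image.

Section ImagePow.
Variables (A B : comPzRingType) (f : {rmorphism A -> B}).

Lemma preimage_ideal (I : set B) : is_ideal I -> is_ideal (f @^-1` I).
Proof.
move=> hI; split=> [|a b /= Ia Ib|a b /= Ib].
- by rewrite /preimage /= rmorph0; exact: ideal0.
- by rewrite /preimage /= rmorphD; exact: idealD.
- by rewrite /preimage /= rmorphM; exact: ideal_mull.
Qed.

Lemma sub_mpow (M : set A) (N : set B) n a :
  (forall a, M a -> N (f a)) -> mpow M n a -> mpow N n (f a).
Proof.
move=> MN; elim: n a => [//|n IH]; rewrite -/(_ `<=` f @^-1` mpow N n.+1).
apply: mpowS_min => [|a b Ma Mb]; first exact: preimage_ideal (mpow_ideal _ _).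
by rewrite /preimage /= rmorphM; apply: mpowS; [exact: MN|exact: IH].
Qed.

Lemma image_mpow (M : set A) n : (forall b, exists a, f a = b) ->
  mpow (f @` M) n = f @` mpow M n.
Proof.
move=> f_surj; apply/seteqP; split=> [|_ [a Ma <-]]; last first.
  by apply: sub_mpow Ma => a' Ma'; exists a'.
elim: n => [b _|n IH]; first by have [a <-] := f_surj b; exists a.
apply: mpowS_min => [|_ b [a Ma <-] /IH[c Mc <-]].
  exact: image_ideal (mpow_ideal _ _).
by exists (a * c); [exact: mpowS|rewrite rmorphM].
Qed.

End ImagePow.

(** * Derivations and splitting off a power series variable *)

Definition der (A : comPzRingType) (E : A -> A) : Prop :=
  (forall a b, E (a + b) = E a + E b) /\
  (forall a b, E (a * b) = a * E b + b * E a).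

Section Derivations.
Variable A : comPzRingType.
Implicit Types (E D : A -> A) (M : set A).

Lemma der0 E : der E -> E 0 = 0.
Proof. by move=> [hD _]; apply: (addrI (E 0)); rewrite -hD !addr0. Qed.

Lemma derN E a : der E -> E (- a) = - E a.
Proof.
move=> hE; apply: (addrI (E a)); rewrite -(hE.1) !subrr; exact: der0.
Qed.

Lemma derB E a b : der E -> E (a - b) = E a - E b.
Proof. by move=> hE; rewrite hE.1 derN. Qed.

Lemma der_sum E (T : Type) (r : seq T) (P : pred T) (f : T -> A) :
  der E -> E (\sum_(i <- r | P i) f i) = \sum_(i <- r | P i) E (f i).
Proof. by move=> hE; apply: (big_morph E hE.1); exact: der0. Qed.

Lemma der1 E : der E -> E 1 = 0.
Proof.
by move=> hE; apply: (addrI (E 1)); rewrite -{3}(mulr1 1) hE.2 mul1r addr0.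
Qed.

Lemma der_nat E n a : der E -> E (n%:R * a) = n%:R * E a.
Proof.
move=> hE; rewrite hE.2 -[n%:R]/(1 *+ n); suff -> : E (1 *+ n) = 0.
  by rewrite mulr0 addr0.
by elim: n => [|n IH]; [exact: der0|rewrite mulrS hE.1 IH addr0; exact: der1].
Qed.

Lemma derX E a n : der E -> E (a ^+ n.+1) = n.+1%:R * a ^+ n * E a.
Proof.
move=> hE; elim: n => [|n IH]; first by rewrite expr1 expr0 !mul1r.
by rewrite exprS hE.2 IH -[in RHS]natr1 exprS; ring.
Qed.

Lemma der_scale E u : der E -> der (fun a => u * E a).
Proof.
by move=> hE; split=> a b; rewrite (hE.1, hE.2); ring.
Qed.

Lemma der_add E D : der E -> der D -> der (fun a => E a + D a).
Proof.
by move=> hE hD; split=> a b; rewrite ?(hE.1, hD.1, hE.2, hD.2); ring.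
Qed.

Lemma der_bracket E D : der E -> der D -> der (fun a => E (D a) - D (E a)).
Proof.
move=> hE hD; split=> a b.
  by rewrite ?(hE.1, hD.1); ring.
by rewrite hE.2 hD.2 hE.1 hD.1 ?hE.2 ?hD.2; ring.
Qed.

(** In a product the Leibniz rule differentiates one factor at a time. Hence every derivation is
    continuous for the powers of [M]. *)
Lemma der_mpow E M n a : der E -> mpow M n.+1 a -> mpow M n (E a).
Proof.
move=> hE; elim: n a => [//|n IH] a Ma.
(* The two memberships are carried together: [E (b * c)] contains the term [c * E b], which is
   controlled by [c] itself. *)
suff /(_ a Ma)[] : mpow M n.+2 `<=` mpow M n.+1 `&` E @^-1` mpow M n.+1 by [].
apply: mpowS_min => [|{Ma} {}a b Ma Mb].
  split=> [|b c [Mb Eb] [Mc Ec]|b c [Mc Ec]]; split=> /=.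
  - exact: mpow0.
  - by rewrite der0 //; exact: mpow0.
  - exact: mpowD.
  - by rewrite hE.1; exact: mpowD.
  - exact: mpowMl.
  - by rewrite hE.2; apply: mpowD; [exact: mpowMl|rewrite mulrC; exact: mpowMl].
split=> /=; first exact: mpowMl.
rewrite hE.2; apply: mpowD; last by rewrite mulrC; exact: mpowMl.
by apply: mpowS => //; exact: IH.
Qed.

End Derivations.

(* Differential simplicity is required with respect to all additive derivations,
   so that it passes to rings of constants. *)
Record good (A : comPzRingType) (M : set A) : Prop := Good {
  good_ideal : is_ideal M;
  good_proper : ~ M 1;
  good_unit : forall a, ~ M a -> exists b, a * b = 1;
  good_sep : forall a, (forall n, mpow M n a) -> a = 0;
  good_lim : forall u : nat -> A, (forall n, mpow M n (u n.+1 - u n)) ->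
    exists b, forall n, mpow M n (b - u n);
  good_nat : forall n, exists b : A, n.+1%:R * b = 1;
  good_simple : forall I : set A, is_ideal I -> ~ I 1 ->
    (forall E, der E -> forall a, I a -> I (E a)) -> forall a, I a -> a = 0 }.

Section Constants.
Variables (B : comNzRingType) (D : B -> B).

(** The derivation property is a parameter so that the subring structure, which depends on it, can
    be inferred from the predicate. *)
Definition constants_pred of der D : {pred B} := [pred a | D a == 0].

Hypothesis derD : der D.

Lemma constants_subring : subring_closed (constants_pred derD).
Proof.
split=> [|a b|a b]; rewrite !inE ?der1 // => /eqP Da /eqP Db.
  by rewrite derB // Da Db subrr.
by rewrite derD.2 Da Db !mulr0 addr0.
Qed.

HB.instance Definition _ :=
  GRing.isSubringClosed.Build B (constants_pred derD) constants_subring.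

Definition constants := {a | a \in constants_pred derD}.
HB.instance Definition _ := SubChoice.on constants.
HB.instance Definition _ := [SubChoice_isSubComNzRing of constants by <:].

End Constants.

(** * Zariski's lemma for a derivation with [D x = 1] *)

Section Slice.
Variables (B : comNzRingType) (M : set B) (D : B -> B) (x : B).
Hypotheses (gB : good M) (derD : der D) (Mx : M x) (Dx : D x = 1).

(** Repeated differentiation gives [(k+1) D^k b = - x D^(k+1) b]. As positive integers are
    invertible, [b] is divisible by every power of [x], hence zero. This yields both uniqueness of
    constant terms and regularity of [x]. *)
Lemma const_mul_eq0 b : D (x * b) = 0 -> b = 0.
Proof.
move=> Dxb.
have step k : k.+1%:R * iter k D b = - (x * iter k.+1 D b).
  elim: k => [|k IH] /=.
    by apply/eqP; rewrite -addr_eq0 -Dxb derD.2 Dx; apply/eqP; ring.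
  have := congr1 D IH; rewrite der_nat // derN // derD.2 Dx /= => IH'.
  by rewrite -natr1 mulrDl IH'; ring.
have div n k : exists c, iter k D b = x ^+ n * c.
  elim: n k => [|n IH] k; first by exists (iter k D b); rewrite mul1r.
  have [v kv] := good_nat gB k; have [c Dc] := IH k.+1.
  exists (- (v * c)); rewrite exprS -[LHS]mul1r -kv mulrAC step Dc; ring.
apply: (good_sep gB) => n; have [c /= ->] := div n 0; rewrite mulrC.
exact/mpowMl/mpow_exp.
Qed.

(* s is the limit of the sums of (-x)^i/i! D^i a, here sums of x^i w_i. *)
Lemma const_decomp a : exists s, D s = 0 /\ exists c, a = s + x * c.
Proof.
have [inv invP] := choice (good_nat gB).
have [w [w0 Dw]] : exists w : nat -> B,
    w 0 = a /\ forall i, D (w i) = - (i.+1%:R * w i.+1).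
  exists (fix w i := if i is j.+1 then - (inv j * D (w j)) else a).
  by split=> // i; rewrite mulrN mulrA invP mul1r opprK.
(* The partial sums of the series for [s] are [a + x * u n]; with [x] factored out, the limit of [u]
   provides the cofactor directly. *)
pose u n := \sum_(i < n) x ^+ i * w i.+1.
have [n|c cP] := @good_lim _ _ gB u.
  rewrite (_ : _ - _ = w n.+1 * x ^+ n); last by rewrite /u big_ord_recr /=; ring.
  apply: mpowMl.
  exact: mpow_exp.
exists (a + x * c); split; last by exists (- c); ring.
apply: (good_sep gB) => n.
(* The derivative telescopes: only a multiple of [x ^+ k] survives. *)
have Du k : D (a + x * u k) = - (k.+1%:R * x ^+ k * w k.+1).
  elim: k => [|k IH]; first by rewrite /u big_ord0 mulr0 addr0 -w0 Dw expr0 mulr1.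
  rewrite /u big_ord_recr /= -/(u k) mulrDr addrA derD.1 IH mulrA -exprS.
  by rewrite derD.2 derX // Dx Dw; ring.
(* The partial sum is taken at [n.+1] because differentiating the error [c - u n.+1] loses one power
   of [M]. *)
have -> : a + x * c = (a + x * u n.+1) + x * (c - u n.+1) by ring.
rewrite derD.1 Du derD.2 Dx mulr1; apply: mpowD; last apply: mpowD.
- apply: idealN (mpow_ideal _ _) _; rewrite mulrAC; apply: mpowMl.
  by apply: mpow_decr; exact: mpow_exp.
- by apply: mpowMl; apply: der_mpow.
- exact: mpow_decr.
Qed.

(** [S] is the ring of constants of [D] and [e] is the evaluation at [x = 0]. That [e] is a ring map
    follows from the uniqueness of the constant term. *)
Lemma slice_retract : exists (S : comNzRingType) (i : {rmorphism S -> B})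
    (e : {rmorphism B -> S}),
  [/\ (forall s, D (i s) = 0), (forall s, e (i s) = s), e x = 0 &
      forall a, exists c, a = i (e a) + x * c].
Proof.
pose S := constants derD.
have uniq (s t : S) c : val s + x * c = val t -> s = t.
  move=> st; apply/val_inj; rewrite -st.
  suff -> : c = 0 by rewrite mulr0 addr0.
  apply: const_mul_eq0; rewrite (_ : x * c = val t - val s); last first.
    by rewrite -st; ring.
  by rewrite derB // (eqP (valP s)) (eqP (valP t)) subrr.
have /choice[e eP] : forall a, exists s : S, exists c, a = val s + x * c.
  move=> a; have [s [Ds [c ac]]] := const_decomp a; have /eqP sP := Ds.
  by exists (Sub s sP); exists c; rewrite SubK.
have eE a (s : S) c : a = val s + x * c -> e a = s.
  move=> as_; have [c' ac'] := eP a; apply: (uniq _ _ (c' - c)).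
  by rewrite mulrBr addrA -ac' as_; ring.
have eB : zmod_morphism e.
  move=> a b; have [c ac] := eP a; have [d bd] := eP b.
  by apply: (eE _ _ (c - d)); rewrite rmorphB {1}ac {1}bd; ring.
have eM : monoid_morphism e.
  split=> [|a b]; first by apply: (eE _ _ 0); rewrite rmorph1 mulr0 addr0.
  have [c ac] := eP a; have [d bd] := eP b.
  apply: (eE _ _ (c * val (e b) + d * val (e a) + x * c * d)).
  by rewrite rmorphM {1}ac {1}bd; ring.
pose e' : {rmorphism B -> S} := HB.pack e
  (GRing.isZmodMorphism.Build _ _ e eB) (GRing.isMonoidMorphism.Build _ _ e eM).
exists S, val, e'; split=> //.
- by move=> s; exact/eqP/(valP s).
- by move=> s; apply: (eE _ _ 0); rewrite mulr0 addr0.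
- by apply: (eE _ _ 1); rewrite rmorph0 mulr1 add0r.
Qed.

End Slice.

(** * Transfer of the properties of [B] to the ring of constants *)

Section SliceTheory.
Variables (B S : comNzRingType) (M : set B) (D : B -> B) (x : B).
Variables (i : {rmorphism S -> B}) (e : {rmorphism B -> S}).
Hypotheses (gB : good M) (derD : der D) (Mx : M x) (Dx : D x = 1).
Hypotheses (Di : forall s, D (i s) = 0) (ei : forall s, e (i s) = s).
Hypotheses (ex : e x = 0) (ie : forall a, exists c, a = i (e a) + x * c).

Local Notation MS := (i @^-1` M).

Lemma slice_surj s : exists a, e a = s.
Proof. by exists (i s). Qed.

Lemma slice_regular b : x * b = 0 -> b = 0.
Proof.
by move=> xb; apply: (const_mul_eq0 gB derD Mx Dx); rewrite xb der0.
Qed.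

Lemma slice_ker a : e a = 0 -> exists c, a = x * c.
Proof.
by have [c ac] := ie a => ea0; exists c; rewrite {1}ac ea0 rmorph0 add0r.
Qed.

Lemma slice_mem a : M a <-> MS (e a).
Proof.
have [c ac] := ie a; apply: (ideal_subl (good_ideal gB)).
by rewrite {1}ac addrC addKr; exact (ideal_mulr (good_ideal gB) Mx).
Qed.

Lemma slice_image : MS = e @` M.
Proof.
apply/seteqP; split=> [s Ms|_ [a + <-]]; last by move/slice_mem.
by exists (i s).
Qed.

Lemma slice_mpow_i n s : mpow MS n s -> mpow M n (i s).
Proof. exact: sub_mpow. Qed.

Lemma slice_mpow_e n a : mpow M n a -> mpow MS n (e a).
Proof. by apply: sub_mpow => b /slice_mem. Qed.

Lemma slice_simple (I : set S) : is_ideal I -> ~ I 1 ->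
  (forall E, der E -> forall a, I a -> I (E a)) -> forall a, I a -> a = 0.
Proof.
move=> hI I1 inv s Is.
(* the ideal of the power series in x with coefficients in I *)
pose J := [set b | forall n, I (e (iter n D b))].
have JD b : J b -> J (D b) by move=> Jb n; rewrite -iterSr; exact: Jb.
have hJ : is_ideal J.
  split=> [n|a b Ja Jb n|a b Jb n].
  - suff -> : iter n D 0 = 0 by rewrite rmorph0; exact: ideal0 hI.
    by elim: n => //= n ->; exact: der0.
  - suff -> : iter n D (a + b) = iter n D a + iter n D b.
      by rewrite rmorphD; apply: (idealD hI).
    by elim: n => //= n ->; exact: derD.1.
  - elim: n a b Jb => [|n IH] a b Jb; first by
      rewrite rmorphM; exact: ideal_mull hI (Jb 0%N).
    have DD c d : iter n D (c + d) = iter n D c + iter n D d.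
      by elim: (n) => //= k ->; exact: derD.1.
    rewrite iterSr derD.2 DD rmorphD; apply: (idealD hI); first exact/IH/JD.
    by rewrite mulrC; exact: IH.
(* The induction runs over all [E] at once, since moving [D] past [E] produces the bracket, which is
   again a derivation. *)
have JE n : forall E, der E -> forall b, J b -> I (e (iter n D (E b))).
  elim: n => [|n IH] E hE b Jb /=.
    (* Write [b = i (e b) + x * c]. The composite of [i], [E] and [e] is a derivation of [S], so it
       handles the first term; the second contributes [e (E x) * e c], and [e c] equals
       [e (D b)]. *)
    have [c bc] := ie b; rewrite bc hE.1 hE.2 !rmorphD !rmorphM ex mul0r add0r.
    apply: (idealD hI).
      apply: (inv (e \o E \o i)); last exact: (Jb 0%N).
      by split=> s1 s2 /=; rewrite ?(rmorphD, rmorphM, hE.1, hE.2) ?ei.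
    apply: (ideal_mulr hI); have := Jb 1%N; rewrite /= bc derD.1 Di derD.2 Dx.
    by rewrite add0r rmorphD !rmorphM ex mul0r add0r rmorph1 mulr1.
  have -> : D (iter n D (E b)) =
      iter n D (E (D b)) + iter n D (D (E b) - E (D b)).
    rewrite -iterS iterSr -{1}(subrK (E (D b)) (D (E b))) addrC.
    by elim: (n) => //= k ->; exact: derD.1.
  rewrite rmorphD; apply: (idealD hI); first exact/IH/JD.
  exact: (IH _ (der_bracket derD hE)).
rewrite -(ei s) (_ : i s = 0) ?rmorph0 //.
apply: (good_simple gB hJ) => [/(_ 0%N)|E hE b Jb n|[|n]]; first by rewrite /= rmorph1.
- exact: JE.
- by rewrite /= ei.
- rewrite iterSr Di; suff -> : iter n D 0 = 0 by rewrite rmorph0; exact: ideal0 hI.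
  by elim: n => //= n ->; exact: der0.
Qed.

(** Inverses and limits are found in [B] and brought back by [e]; both [i] and [e] respect the
    powers of the maximal ideals. *)
Lemma slice_good : good MS.
Proof.
have hM := good_ideal gB.
split=> [||s Ms|s Ms|u uP|n|]; last exact: slice_simple.
- exact: preimage_ideal.
- by rewrite /preimage /= rmorph1; exact: good_proper gB.
- have [b ab] := good_unit gB Ms; exists (e b).
  by rewrite -[s]ei -rmorphM ab rmorph1.
- rewrite -(ei s) (_ : i s = 0) ?rmorph0 //; apply: (good_sep gB) => n.
  exact: slice_mpow_i.
- have [n|b bP] := @good_lim _ _ gB (i \o u).
    by rewrite /= -rmorphB; exact: slice_mpow_i.
  exists (e b) => n; rewrite -[u n]ei -rmorphB; exact: slice_mpow_e.
- have [b nb] := good_nat gB n; exists (e b).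
  by have := congr1 e nb; rewrite rmorphM rmorph_nat rmorph1.
Qed.

Lemma slice_gen (r : seq B) : x \in r -> M = ideal_gen [set` r] ->
  MS = ideal_gen [set` map e (rem x r)].
Proof.
move=> xr Mr; rewrite slice_image Mr (image_ideal_gen slice_surj).
have hI := ideal_gen_ideal; apply/seteqP; split; apply: ideal_gen_min => // s.
  move=> /mapP[a + ->]; rewrite (perm_mem (perm_to_rem xr)) inE => /predU1P[->|ar].
    by rewrite ex; exact: ideal0 (hI _ _).
  by apply: sub_ideal_gen; exact: map_f.
move=> /mapP[a /mem_rem ar ->]; apply: sub_ideal_gen; exact: map_f.
Qed.

End SliceTheory.

(** * Noetherianity and existence of long chains of primes *)

Section Noetherian.
Variables (B S : comNzRingType) (M : set B) (D : B -> B) (x : B).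
Variables (i : {rmorphism S -> B}) (e : {rmorphism B -> S}).
Hypotheses (gB : good M) (derD : der D) (Mx : M x) (Dx : D x = 1).
Hypotheses (Di : forall s, D (i s) = 0) (ei : forall s, e (i s) = s).
Hypotheses (ex : e x = 0) (ie : forall a, exists c, a = i (e a) + x * c).
Hypothesis S_noeth : noetherian S.

Lemma slice_lift_gen (I : set B) : is_ideal I -> exists s : seq B,
  (forall a, a \in s -> I a) /\
  forall a, I a -> exists (c : nat -> B) a', a = lcomb s c + x * a'.
Proof.
move=> hI; have e_surj := slice_surj ei.
have [t tI] := S_noeth (image_ideal e_surj hI).
(* Off the image of [I] the lift is the constant [i s], so that [e] inverts the choice function
   everywhere. *)
have /choice[g gP] : forall s, exists a, e a = s /\ ((e @` I) s -> I a).
  move=> s; have [[a Ia <-]|nI] := pselect ((e @` I) s); first by exists a.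
  by exists (i s).
have egt : map e (map g t) = t.
  by rewrite -map_comp map_id_in // => s _; exact: (gP s).1.
exists (map g t); split=> [_ /mapP[s st ->]|a Ia].
  by apply: (gP s).2; rewrite tI; exact: sub_ideal_gen.
have : (e @` I) (e a) by exists a.
rewrite tI lcombP => -[c _ ce]; exists (i \o c).
have [|a' aE] := slice_ker ie (a := a - lcomb (map g t) (i \o c)).
  rewrite rmorphB image_lcomb egt -ce (_ : e \o _ = c) ?subrr //.
  by apply/funext => j; exact: ei.
by exists a'; rewrite -aE addrC subrK.
Qed.

(** The remainder [x * a'] of a first expansion lies in [J], so by saturation [a'] does too and can
    be expanded in turn along the same list. The coefficients accumulate into convergent power
    series in [x]. *)
Lemma slice_saturated_fg (J : set B) : is_ideal J ->
  (forall b, J (x * b) -> J b) -> exists s : seq B, J = ideal_gen [set` s].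
Proof.
move=> hJ Jx; have [s [sJ sP]] := slice_lift_gen hJ; exists s.
have /choice[F FP] : forall a, exists ca : (nat -> B) * B,
    J a -> a = lcomb s ca.1 + x * ca.2 /\ J ca.2.
  move=> a; have [Ja|nJ] := pselect (J a); last by exists (fun=> 0, 0) => /nJ.
  have [c [a' aE]] := sP a Ja; exists (c, a') => _; split=> //=; apply: Jx.
  rewrite (_ : x * a' = a - lcomb s c); last by rewrite {1}aE; ring.
  apply: (idealB hJ) => //; apply: (ideal_sum hJ) => k _.
  by apply: (ideal_mull hJ); apply: sJ; rewrite mem_nth.
apply/seteqP; split=> [a Ja|]; last exact: ideal_gen_min.
pose w n := iter n (fun b => (F b).2) a.
have Jw n : J (w n) by elim: n => //= n IH; have [] := FP _ IH.
pose u j n := \sum_(k < n) x ^+ k * (F (w k)).1 j.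
have uS j n : u j n.+1 = u j n + x ^+ n * (F (w n)).1 j.
  by rewrite /u big_ord_recr.
have aE n : a = lcomb s (u ^~ n) + x ^+ n * w n.
  elim: n => [|n IH].
    rewrite expr0 mul1r /lcomb big1 ?add0r // => j _.
    by rewrite /u big_ord0 mul0r.
  rewrite {1}IH [in LHS](FP _ (Jw n)).1 /= mulrDr addrA mulrA -exprSr.
  congr (_ + _); rewrite /lcomb mulr_sumr -big_split; apply: eq_bigr => j _ /=.
  by rewrite uS mulrDl mulrA.
have /choice[c cP] : forall j, exists c, forall n, mpow M n (c - u j n).
  move=> j; apply: (good_lim gB) => n; rewrite uS addrC addKr.
  by rewrite mulrC; apply: mpowMl; exact: mpow_exp.
rewrite (_ : a = lcomb s c); first exact: lcomb_gen.
apply/eqP; rewrite -subr_eq0; apply/eqP/(good_sep gB) => n.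
rewrite {1}(aE n) (_ : _ - _ = x ^+ n * w n - lcomb s (fun j => c j - u j n)).
  apply: idealB (mpow_ideal _ _) _ _.
    by rewrite mulrC; apply: mpowMl; exact: mpow_exp.
  by apply: ideal_sum (mpow_ideal _ _) _ => j _; rewrite mulrC; exact: mpowMl.
have -> : lcomb s (fun j => c j - u j n) = lcomb s c - lcomb s (u ^~ n).
  by rewrite /lcomb -sumrB; apply: eq_bigr => j _; rewrite mulrBl.
ring.
Qed.

(* Hilbert's basis theorem for power series in x over S *)
Lemma slice_noetherian : noetherian B.
Proof.
move=> I hI; pose J := [set b | exists k, I (x ^+ k * b)].
have up k l b : (k <= l)%N -> I (x ^+ k * b) -> I (x ^+ l * b).
  by move/subnK <- => Ib; rewrite exprD -mulrA; exact: (ideal_mull hI).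
have [||s JE] := @slice_saturated_fg J.
- split=> [|a b [k Ia] [l Ib]|a b [k Ib]].
  + by exists 0%N; rewrite mulr0; exact (ideal0 hI).
  + exists (maxn k l); rewrite mulrDr; apply: (idealD hI).
      by apply: up Ia; rewrite leq_maxl.
    by apply: up Ib; rewrite leq_maxr.
  + by exists k; rewrite mulrCA; exact: (ideal_mull hI).
- by move=> b [k Ib]; exists k.+1; rewrite exprSr -mulrA.
have [N NP] : exists N, forall a, a \in s -> I (x ^+ N * a).
  have : forall a, a \in s -> J a by rewrite JE => a sa; exact: sub_ideal_gen.
  elim: (s) => [|a t IH] Jt; first by exists 0%N.
  have [N NP] := IH (fun b bt => Jt b (@mem_behead _ (a :: t) b bt)).
  have [k ka] := Jt a (mem_head _ _); exists (maxn k N) => b.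
  rewrite inE => /predU1P[->|/NP]; first by apply: up ka; rewrite leq_maxl.
  by apply: up; rewrite leq_maxr.
have scale (t : seq B) (c : nat -> B) y :
    y * lcomb t c = lcomb (map ( *%R y) t) c.
  rewrite /lcomb mulr_sumr size_map; apply: eq_bigr => j _.
  by rewrite (nth_map 0) // mulrCA.
(* Finitely many elements of [I] generate an ideal containing all multiples of [x ^+ N] in [I]. The
   exponent is then lowered to 0 one step at a time. *)
have : exists t : seq B, (forall a, a \in t -> I a) /\
    forall b, I (x ^+ N * b) -> ideal_gen [set` t] (x ^+ N * b).
  exists (map ( *%R (x ^+ N)) s); split=> [_ /mapP[a /NP ? ->] //|b Ib].
  have : J b by exists N.
  by rewrite JE lcombP => -[c _ <-]; rewrite scale; exact: lcomb_gen.
elim: (N) => [[t [tI tP]]|n IH [t [tI tP]]].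
  exists t; apply/seteqP; split; last exact: ideal_gen_min.
  by move=> b Ib; rewrite -(mul1r b); apply: tP; rewrite mul1r.
(* [v] generates, modulo [x], the colon ideal of [I] by [x ^+ n]; after subtracting a combination of
   [v], a multiple of [x ^+ n] in [I] becomes a multiple of [x ^+ n.+1]. *)
apply: IH; have [|v [vI vP]] := @slice_lift_gen [set b | I (x ^+ n * b)].
  split=> [|a b /= Ia Ib|a b /= Ib].
  - by rewrite /= mulr0; exact (ideal0 hI).
  - by rewrite mulrDr; exact: (idealD hI).
  - by rewrite mulrCA; exact: (ideal_mull hI).
exists (map ( *%R (x ^+ n)) v ++ t); split=> [a|b Ib].
  by rewrite mem_cat => /orP[/mapP[? /vI ? ->]|/tI].
have [c [b' bE]] := vP b Ib; rewrite bE mulrDr mulrA -exprSr scale.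
have mono (p q : seq B) b0 : {subset p <= q} ->
    ideal_gen [set` p] b0 -> ideal_gen [set` q] b0.
  move=> pq; move: b0; apply: ideal_gen_min => [|a /pq aq].
    exact: ideal_gen_ideal.
  exact: sub_ideal_gen.
apply: idealD (ideal_gen_ideal _) _ _.
  by apply: (mono _ _ _ _ (lcomb_gen _ _)) => a av; rewrite mem_cat av.
apply: (mono t) => [a ta|]; first by rewrite mem_cat ta orbT.
apply: tP; rewrite (_ : _ * b' = x ^+ n * b - x ^+ n * lcomb v c); last first.
  by rewrite bE exprSr; ring.
apply: (idealB hI) => //; rewrite scale; apply: (ideal_sum hI) => j _.
apply: (ideal_mull hI); have /mapP[a /vI ? -> //] : (map ( *%R (x ^+ n)) v)`_j
  \in map ( *%R (x ^+ n)) v by rewrite mem_nth.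
Qed.

End Noetherian.

Definition idomain (A : comPzRingType) : Prop :=
  forall a b : A, a * b = 0 -> a = 0 \/ b = 0.

Lemma prime_chainP (A : comPzRingType) n : prime_chain A n <->
  exists P : nat -> set A, (forall j, (j <= n)%N -> prime_ideal (P j)) /\
    (forall j, (j < n)%N -> P j `<` P j.+1).
Proof.
split=> [[P [Pp Plt]]|[P [Pp Plt]]].
  exists (fun j => P (inord j)); split=> // j jn; apply: Plt.
  by rewrite !inordK // ltnW.
exists (fun j => P j); split=> [j|j l].
  by apply: Pp; rewrite -ltnS.
have := ltn_ord l; rewrite ltnS; elim: (nat_of_ord l) => // k IH kn.
rewrite ltnS leq_eqVlt => /predU1P[->|jk]; first exact: Plt.
have [jk1 _] := IH (ltnW kn) jk; have [kk nkk] := Plt _ kn.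
by split=> [|kj]; [exact: subset_trans jk1 kk|apply/nkk/(subset_trans kj)].
Qed.

Section GoodRing.
Variables (B : comNzRingType) (M : set B).
Hypothesis gB : good M.

Lemma good_sub_max (I : set B) : is_ideal I -> ~ I 1 -> I `<=` M.
Proof.
move=> hI I1 a Ia; apply: contrapT => /(good_unit gB)[b ab].
by apply: I1; rewrite -ab; exact: ideal_mulr hI Ia.
Qed.

Lemma good_maximal : maximal_ideal M.
Proof.
split; [exact: good_ideal gB|exact: good_proper gB|move=> J hJ MJ].
have [J1|J1] := pselect (J 1); first by right; exact: ideal_eqT.
by left; apply/seteqP; split=> //; exact: good_sub_max.
Qed.

Lemma good_max_uniq M' : maximal_ideal M' -> M' = M.
Proof.
move=> [hM' M'1 M'max].
have [-> //|MT] := M'max M (good_ideal gB) (good_sub_max hM' M'1).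
by case: (good_proper gB); rewrite MT.
Qed.

Lemma good_moves f : M f -> f <> 0 -> exists2 E, der E & exists2 a, M a & ~ M (E a).
Proof.
move=> Mf f0; apply: contrapT => noE; apply: f0.
apply: (good_simple gB (good_ideal gB)) Mf; first exact: good_proper gB.
move=> E hE a Ma; apply: contrapT => MEa; apply: noE; exists E => //.
by exists a.
Qed.

(** By the Leibniz rule the members of [M] that [E] keeps in [M] form an ideal, so some generator
    must be moved out. *)
Lemma der_moves_gen E (r : seq B) a : der E -> M = ideal_gen [set` r] -> M a ->
  ~ M (E a) -> exists2 x, x \in r & ~ M (E x).
Proof.
move=> hE Mr Ma MEa; apply: contrapT => noX; apply: MEa.
have hM := good_ideal gB.
suff: M `<=` [set a | M a /\ M (E a)] by move=> /(_ a Ma)[].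
rewrite {1}Mr; apply: ideal_gen_min => [|x xr].
  split=> [|b c [Mb Eb] [Mc Ec]|b c [Mc Ec]]; split.
  - exact: ideal0 hM.
  - by rewrite der0 //; exact: ideal0 hM.
  - exact: (idealD hM).
  - by rewrite hE.1; exact: (idealD hM).
  - exact: (ideal_mull hM).
  - rewrite hE.2; apply: (idealD hM); first exact: ideal_mull hM Ec.
    exact: ideal_mulr hM Mc.
split; first by rewrite Mr; exact: sub_ideal_gen.
by apply: contrapT => MEx; apply: noX; exists x.
Qed.

End GoodRing.

Section SliceStep.
Variables (B S : comNzRingType) (M : set B) (D : B -> B) (x : B).
Variables (i : {rmorphism S -> B}) (e : {rmorphism B -> S}).
Hypotheses (gB : good M) (derD : der D) (Mx : M x) (Dx : D x = 1).
Hypotheses (Di : forall s, D (i s) = 0) (ei : forall s, e (i s) = s).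
Hypotheses (ex : e x = 0) (ie : forall a, exists c, a = i (e a) + x * c).

(** [k] is the order of [a] as a power series in [x]. It exists because an element divisible by all
    powers of [x] is zero. *)
Lemma slice_order a : a <> 0 -> exists k a', a = x ^+ k * a' /\ e a' <> 0.
Proof.
move=> a0; apply: contrapT => no; apply: a0; apply: (good_sep gB) => n.
have [b ->] : exists b, a = x ^+ n * b.
  elim: n => [|n [b aE]]; first by exists a; rewrite mul1r.
  have [eb|eb] := pselect (e b = 0); last by case: no; exists n, b.
  by have [c bE] := slice_ker ie eb; exists c; rewrite aE bE exprSr mulrA.
by rewrite mulrC; apply: mpowMl; exact: mpow_exp.
Qed.

Lemma slice_regularX n b : x ^+ n * b = 0 -> b = 0.
Proof.
elim: n => [|n IH]; first by rewrite mul1r.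
by rewrite exprS -mulrA => /(slice_regular gB derD Mx Dx).
Qed.

Lemma slice_idomain : idomain S -> idomain B.
Proof.
move=> dS a b ab0; have [->|a0] := pselect (a = 0); first by left.
right; apply: contrapT => b0.
have [k [a' [aE ea']]] := slice_order a0.
have [l [b' [bE eb']]] := slice_order b0.
have /slice_regularX ab' : x ^+ (k + l) * (a' * b') = 0.
  by rewrite -ab0 aE bE exprD; ring.
by case: (dS (e a') (e b')); rewrite // -rmorphM ab' rmorph0.
Qed.

(** The preimages under [e] all contain [x], which is nonzero because [D x = 1]; so the zero ideal,
    prime in a domain, fits strictly below them. *)
Lemma slice_chain n : idomain B -> prime_chain S n -> prime_chain B n.+1.
Proof.
move=> dB /prime_chainP[P [Pp Plt]]; apply/prime_chainP.
exists (fun j => if j is j'.+1 then e @^-1` P j' else [set 0]).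
have M0 (I : set S) : is_ideal I -> [set 0] `<` e @^-1` I.
  move=> hI; split=> [_ ->|/(_ x)].
    by rewrite /preimage /= rmorph0; exact: ideal0.
  rewrite /preimage /= ex => /(_ (ideal0 hI)) x0.
  by have := Dx; rewrite x0 der0 // => /eqP; rewrite eq_sym oner_eq0.
split=> [[|j] jn|[|j] jn].
- split=> [|/eqP|a b /dB //]; last by rewrite oner_eq0.
  by split=> [|a b -> ->|a b ->] //=; rewrite ?addr0 ?mulr0.
- have [hP P1 PM] := Pp j jn; split; first exact: preimage_ideal.
    by rewrite /preimage /= rmorph1.
  by move=> a b; rewrite /preimage /= rmorphM; exact: PM.
- by apply: M0; have [] := Pp 0%N isT.
- have [sub nsub] := Plt j jn; split=> [a|h]; first exact: sub.
  apply: nsub => s Ps; rewrite -(ei s); apply: h.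
  by rewrite /preimage /= ei.
Qed.

Lemma slice_gen_lift (r : seq S) : i @^-1` M = ideal_gen [set` r] ->
  M = ideal_gen [set` x :: map i r].
Proof.
move=> MSr; have hM := good_ideal gB; apply/seteqP; split=> [a Ma|].
  have [c ->] := ie a; apply: idealD (ideal_gen_ideal _) _ _; last first.
    apply: ideal_mulr (ideal_gen_ideal _) _; apply: sub_ideal_gen.
    exact: mem_head.
  have : (i @^-1` M) (e a) by apply: (slice_mem gB Mx ie a).1.
  rewrite MSr lcombP => -[c' _ <-]; rewrite image_lcomb.
  have [f ->] : exists f, lcomb (map i r) (i \o c') = lcomb (x :: map i r) f.
    exists (fun j => if j is j'.+1 then i (c' j') else 0).
    by rewrite /lcomb big_ord_recl mul0r add0r.
  exact: lcomb_gen.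
apply: ideal_gen_min => // a; rewrite /= inE => /predU1P[-> //|/mapP[s sr ->]].
have : ideal_gen [set` r] s by exact: sub_ideal_gen.
by rewrite -MSr.
Qed.

End SliceStep.

(** The list [s] may differ from [r]: its length is that of a chain of primes, and [good_chain_le]
    applied to [s] then makes it the dimension. *)
Lemma good_structure (B : comNzRingType) (M : set B) (r : seq B) :
  good M -> M = ideal_gen [set` r] ->
  [/\ noetherian B, idomain B & exists s : seq B,
    M = ideal_gen [set` s] /\ prime_chain B (size s)].
Proof.
have [n] := ubnP (size r); elim: n B M r => // n IH B M r rn gB Mr.
have [[f [Mf f0]]|M0] := pselect (exists f, M f /\ f <> 0).
  have [E0 hE0 [a Ma ME0a]] := good_moves gB Mf f0.
  have [x xr ME0x] := der_moves_gen gB hE0 Mr Ma ME0a.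
  (* Dividing [E0] by the unit [E0 x] gives a derivation with value 1 at [x]. *)
  have [v Ev] := good_unit gB ME0x.
  have derD := der_scale v hE0.
  have Dx : v * E0 x = 1 by rewrite mulrC.
  have Mx : M x by rewrite Mr; exact: sub_ideal_gen.
  have [S [i [e [Di ei ex ie]]]] := slice_retract gB derD Mx Dx.
  have gS := slice_good gB derD Mx Dx Di ei ex ie.
  have MSr := slice_gen gB Mx ei ex ie xr Mr.
  have [|nS dS [s [MSs chS]]] := IH _ _ _ _ gS MSr.
    by rewrite size_map size_rem //; case: (r) xr rn.
  have dB := slice_idomain gB derD Mx Dx ie dS.
  split=> //; first exact: (slice_noetherian gB Mx ei ie nS).
  exists (x :: map i s); split; first exact: (slice_gen_lift gB Mx ie MSs).
  rewrite /= size_map; exact: (slice_chain derD Dx ei ex dB chS).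
(* In the remaining case [M] is zero and [B] is a field. *)
have {}M0 a : M a -> a = 0.
  by move=> Ma; apply: contrapT => a0; apply: M0; exists a.
have inv (a : B) : a <> 0 -> exists b, a * b = 1.
  by move=> a0; have /(good_unit gB) : ~ M a by move/M0.
have dB : idomain B.
  move=> a b ab; have [->|/inv[c ac]] := pselect (a = 0); first by left.
  by right; rewrite -(mul1r b) -ac mulrAC ab mul0r.
have nil : ideal_gen [set` [::]] = [set (0 : B)].
  rewrite lcombP; apply/seteqP; split=> [_ [c _ <-]|_ ->].
    by rewrite /lcomb big_ord0.
  by exists (fun=> 0) => //; rewrite /lcomb big_ord0.
have M0E : M = [set 0].
  apply/seteqP; split=> [a /M0 //|_ ->]; exact: ideal0 (good_ideal gB).
split=> // [I hI|].
  have [[a [Ia /inv[b ab]]]|I0] := pselect (exists a, I a /\ a <> 0).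
    have I1 : I 1 by rewrite -ab; exact: ideal_mulr hI Ia.
    exists [:: 1]; rewrite (ideal_eqT hI I1).
    rewrite (@ideal_eqT _ (ideal_gen _)) //; first exact: ideal_gen_ideal.
    by apply: sub_ideal_gen; exact: mem_head.
  exists [::]; rewrite nil; apply/seteqP; split=> [a Ia|_ ->]; last exact: ideal0 hI.
  by apply: contrapT => a0; apply: I0; exists a.
exists [::]; rewrite nil; split=> //; apply/prime_chainP; exists (fun=> M).
split=> // _ _; split; [exact: good_ideal gB|exact: good_proper gB|].
by rewrite M0E => a b /dB.
Qed.

(** * Differential order and polarization *)

Section DifferentialOrder.
Variables (B : comNzRingType) (M : set B).
Hypothesis gB : good M.

(* Elements sent into M by all compositions of fewer than d derivations. *)
Fixpoint dorder d : set B :=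
  if d is d'.+1 then [set f | M f /\ forall E, der E -> dorder d' (E f)]
  else setT.

Lemma dorder_decr d : dorder d.+1 `<=` dorder d.
Proof.
elim: d => [//|d IH] f [Mf fE]; split=> // E hE.
exact: IH (fE E hE).
Qed.

Lemma dorder_ideal d : is_ideal (dorder d).
Proof.
have hM := good_ideal gB.
elim: d => [|d IH]; first exact: setT_ideal.
split=> [|a b [Ma aE] [Mb bE]|a b [Mb bE]]; split.
- exact: ideal0 hM.
- by move=> E hE; rewrite der0 //; exact: ideal0 IH.
- exact: (idealD hM).
- by move=> E hE; rewrite hE.1; apply: (idealD IH); [exact: aE|exact: bE].
- exact: (ideal_mull hM).
- move=> E hE; rewrite hE.2; apply: (idealD IH).
    exact: ideal_mull IH (bE E hE).
  by apply: (ideal_mulr IH); exact: dorder_decr.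
Qed.

Lemma dorder_der d E f : der E -> dorder d f -> dorder d.-1 (E f).
Proof. by case: d => [//|d] hE [_]; apply. Qed.

Lemma dorder_iter d j D f : der D -> dorder d f -> dorder (d - j) (iter j D f).
Proof.
move=> hD df; elim: j => [|j IH]; first by rewrite subn0.
by rewrite subnS; exact: (dorder_der hD IH).
Qed.

(** The elements of infinite order form a proper ideal stable under all derivations, so differential
    simplicity applies. *)
Lemma dorder_fin f : f <> 0 -> exists d, dorder d f /\ ~ dorder d.+1 f.
Proof.
move=> f0; apply: contrapT => no; apply: f0.
have fd d : dorder d f.
  by elim: d => [//|d IH]; apply: contrapT => nd; apply: no; exists d.
apply: (@good_simple _ _ gB [set f | forall d, dorder d f]) => //.
- split=> [d|a b ha hb d|a b hb d].
  + exact: ideal0 (dorder_ideal d).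
  + exact: idealD (dorder_ideal d) (ha d) (hb d).
  + exact: ideal_mull (dorder_ideal d) (hb d).
- by move=> /(_ 1%N)[+ _]; exact: good_proper gB.
- by move=> E hE a ha d; exact: dorder_der hE (ha d.+1).
Qed.

(** In each correction term a bracket replaces two derivations by one, so the order drops by [j]
    instead of [j.+1]. *)
Lemma dorder_comm d j D E f : der D -> der E -> dorder d f ->
  dorder (d - j) (E (iter j D f) - iter j D (E f)).
Proof.
move=> hD hE; elim: j d f => [|j IH] d f df.
  by rewrite subrr; exact: ideal0 (dorder_ideal _).
have iterB k a b : iter k D (a - b) = iter k D a - iter k D b.
  by elim: k => //= k ->; rewrite derB.
rewrite !iterSr (_ : _ - _ = (E (iter j D (D f)) - iter j D (E (D f)))
  + iter j D (E (D f) - D (E f))); last by rewrite iterB; ring.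
rewrite -addn1 subnDAC subn1; apply: (idealD (dorder_ideal _)).
  exact: IH (dorder_der hD df).
exact: dorder_iter hD (dorder_der (der_bracket hE hD) df).
Qed.

(** In each term of the difference some derivation is spent on a power of [v], so at most [j] of
    them act on [f]. *)
Lemma dorder_scale d j D v f : der D -> dorder d f ->
  dorder (d - j) (iter j.+1 (fun a => v * D a) f - v ^+ j.+1 * iter j.+1 D f).
Proof.
move=> hD df; elim: j => [|j IH].
  by rewrite /= expr1 subrr; exact: ideal0 (dorder_ideal _).
rewrite -[iter j.+2 (fun _ => _) f]/(v * D (iter j.+1 (fun a => v * D a) f)).
rewrite -[iter j.+2 D f]/(D (iter j.+1 D f)).
set a := iter j.+1 _ f in IH *; set b := iter j.+1 D f in IH *.
rewrite (_ : _ - _ = v * D (a - v ^+ j.+1 * b) + v * D (v ^+ j.+1) * b).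
  apply: (idealD (dorder_ideal _)); apply: (ideal_mull (dorder_ideal _)).
    by rewrite subnS; exact: dorder_der.
  exact: dorder_iter.
by rewrite derB // hD.2 [v ^+ j.+2]exprS; ring.
Qed.

End DifferentialOrder.

Arguments dorder : simpl never.

Section Vandermonde.
Variables (B : comNzRingType) (M : set B).
Hypothesis gB : good M.

(** Evaluation at [0, ..., n-1] is given by a Vandermonde matrix. Its determinant is a product of
    positive integers, hence a unit, and the adjugate recovers the coefficients. *)
Lemma good_coef n (c : nat -> B) :
  (forall t : nat, M (\sum_(k < n) c k * t%:R ^+ k)) ->
  forall k, (k < n)%N -> M (c k).
Proof.
move=> Mc k kn; have hM := good_ideal gB.
pose a : 'rV[B]_n := \row_j j%:R.
have [v dv] : exists v, \det (Vandermonde n a) * v = 1.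
  rewrite det_Vandermonde.
  elim/big_ind: _ => [|b1 b2 [v1 h1] [v2 h2]|l _].
  - by exists 1; rewrite mulr1.
  - by exists (v1 * v2); rewrite mulrACA h1 h2 mulr1.
  elim/big_ind: _ => [|b1 b2 [v1 h1] [v2 h2]|j lj].
  - by exists 1; rewrite mulr1.
  - by exists (v1 * v2); rewrite mulrACA h1 h2 mulr1.
  rewrite !mxE -natrB ?(ltnW lj) //; move: lj; rewrite -subn_gt0.
  case: (j - l)%N => // p _; exact: good_nat gB p.
pose w : 'rV[B]_n := \row_j c j.
have Mw j : M ((w *m Vandermonde n a) 0 j).
  rewrite mxE; have := Mc j; congr M; apply: eq_bigr => l _.
  by rewrite !mxE.
have := congr1 (fun A : 'rV[B]_n => A 0 (Ordinal kn))
  (mulmxA w (Vandermonde n a) (\adj (Vandermonde n a))).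
rewrite mul_mx_adj mul_mx_scalar !mxE /= => E.
rewrite -(mul1r (c k)) -dv mulrAC E; apply: (ideal_mulr hM).
by apply: (ideal_sum hM) => j _; apply: (ideal_mulr hM).
Qed.

End Vandermonde.

Section Polarization.
Variables (B : comNzRingType) (M : set B).
Hypothesis gB : good M.

(* In characteristic 0 a symmetric multilinear form, here
   (E_1, ..., E_d) |-> E_1 ... E_d f mod M, vanishes if its diagonal does: for
   all t the diagonal value at D + t E is a polynomial in t whose linear
   coefficient is d times the value at (D, ..., D, E). *)
Lemma dorder_diagonal d f : dorder M d f ->
  (forall D, der D -> M (iter d D f)) -> dorder M d.+1 f.
Proof.
have hM := good_ideal gB.
have der00 : der (fun _ : B => 0) by split=> *; ring.
elim: d f => [|d IH] f df Mdf.
  by split=> //; exact: (Mdf (fun=> 0)).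
split=> [|E hE]; first by case: df.
apply: IH => [|D hD]; first exact: dorder_der hE df.
(* [c j k] is the coefficient of [t^k] in [(D + t E)^j f], that is, the sum over the words of length
   [j] in [D] and [E] with [k] letters [E]. *)
pose c := fix c j k := if j is j'.+1 then
    D (c j' k) + (if k is k'.+1 then E (c j' k') else 0)
  else if k is 0%N then f else 0.
have cS j k : c j.+1 k =
    D (c j k) + (if k is k'.+1 then E (c j k') else 0) by [].
have c_big j k : (j < k)%N -> c j k = 0.
  elim: j k => [|j IHj] [|k] // jk; rewrite cS IHj ?IHj // ?(ltnW jk) //.
  by rewrite (der0 hD) (der0 hE) addr0.
have c0 j : c j 0%N = iter j D f.
  by elim: j => // j IHj; rewrite cS IHj addr0.
have hc t j : iter j (fun a => D a + t%:R * E a) f =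
    \sum_(k < j.+1) c j k * t%:R ^+ k.
  elim: j => [|j IHj].
    by rewrite big_ord_recl big_ord0 expr0 mulr1 addr0.
  rewrite iterS IHj (der_sum _ _ _ hD) (der_sum _ _ _ hE).
  under [in RHS]eq_bigr => k _ do rewrite cS mulrDl.
  rewrite [in RHS]big_split; congr (_ + _).
    rewrite [in RHS]big_ord_recr /= c_big // der0 // mul0r addr0.
    by apply: eq_bigr => k _; rewrite -natrX mulrC der_nat // mulrC.
  rewrite [in RHS]big_ord_recl /= mul0r add0r mulr_sumr; apply: eq_bigr => k _ /=.
  by rewrite exprS -natrX [c j k * _]mulrC der_nat //; ring.
(* Up to brackets, each of the [j.+1] words with a single [E] can be rewritten with [E] applied
   first. *)
have c1 j : dorder M (d.+1 - j) (c j.+1 1%N - j.+1%:R * iter j D (E f)).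
  elim: j => [|j IHj].
    by rewrite cS /= (der0 hD) add0r mul1r subrr; exact: ideal0 (dorder_ideal gB _).
  rewrite cS c0 (_ : _ - _ =
      D (c j.+1 1%N - j.+1%:R * iter j D (E f)) +
      (E (iter j.+1 D f) - iter j.+1 D (E f))).
    apply: (idealD (dorder_ideal gB _)); last exact: dorder_comm.
    by rewrite subnS; exact: dorder_der.
  by rewrite (derB _ _ hD) (der_nat _ _ hD) !iterS; ring.
(* For every natural [t] the map [D + t E] is a derivation, so the polynomial with these [d.+2]
   coefficients takes values in [M]. *)
have Mc1 : M (c d.+1 1%N).
  apply: (good_coef gB (n := d.+2) (c := c d.+1)) => // t; rewrite -hc.
  apply: Mdf; exact: der_add hD (der_scale _ hE).
have [v vd] := good_nat gB d.
rewrite -[iter _ _ _]mul1r -vd mulrAC; apply: (ideal_mulr hM).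
have := c1 d; rewrite subSnn => -[+ _]; move/(ideal_swap hM)/(idealD hM)/(_ Mc1).
by rewrite subrK.
Qed.

Lemma good_iter_moves f : M f -> f <> 0 -> exists d D,
  [/\ dorder M d.+1 f, der D & ~ M (iter d.+1 D f)].
Proof.
move=> Mf f0; have [[|d] [df ndf]] := dorder_fin gB f0.
  by case: ndf; split.
exists d; apply: contrapT => no; apply: ndf; apply: dorder_diagonal => // D hD.
by apply: contrapT => MD; apply: no; exists D.
Qed.

(** A derivation whose iterates carry [f] out of [M] moves some generator [x] out of [M]. Dividing
    it by its value at [x] only multiplies the last iterate by a unit modulo [M], by
    [dorder_scale]. *)
Lemma good_adapted_derivation (r : seq B) f : M = ideal_gen [set` r] ->
  M f -> f <> 0 -> exists x D d,
  [/\ x \in r, der D, D x = 1 & ~ M (iter d D f)].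
Proof.
move=> Mr Mf f0; have hM := good_ideal gB.
have [d [D [df hD Mdf]]] := good_iter_moves Mf f0.
have [a Ma MDa] : exists2 a, M a & ~ M (D a).
  apply: contrapT => no; apply: Mdf.
  elim: d.+1 => //= k Mk; apply: contrapT => MDk; apply: no.
  by exists (iter k D f).
have [x xr MDx] := der_moves_gen gB hD Mr Ma MDa.
have [v Dv] := good_unit gB MDx.
exists x, (fun a => v * D a), d.+1; split=> //; first exact: der_scale.
  by rewrite mulrC.
move=> Mvd; apply: Mdf.
have := dorder_scale gB d v hD df; rewrite subSnn => -[Mdiff _].
have Mvdf := (ideal_subl hM Mdiff).1 Mvd.
rewrite -[iter _ _ _]mul1r -(expr1n _ d.+1) -Dv.
by rewrite exprMn -mulrA; exact: (ideal_mull hM).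
Qed.

End Polarization.

(** * Weierstrass division and the upper bound on chains of primes *)

Lemma char_poly_horner (A : comNzRingType) n (N : 'M[A]_n) a :
  (char_poly N).[a] = \det (a%:M - N).
Proof.
rewrite -[LHS]/(horner_eval a (\det _)) -det_map_mx; congr (\det _).
apply/matrixP => k l; rewrite /char_poly_mx !mxE /= /horner_eval.
by rewrite hornerD hornerN hornerMn hornerX hornerC.
Qed.

(** The determinant trick modulo [Q]: the adjugate of [a - N] turns the relations into one for the
    characteristic polynomial of [N]. *)
Lemma integral_of_relations (A C : comNzRingType) (i : {rmorphism A -> C})
    (Q : set C) n (t : nat -> C) (N : nat -> nat -> A) a :
  is_ideal Q ->
  (forall j, (j < n)%N -> Q (a * t j - \sum_(l < n) i (N j l) * t l)) ->
  exists2 p : {poly A}, p \is monic &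
    forall j, (j < n)%N -> Q ((map_poly i p).[a] * t j).
Proof.
move=> hQ rel; pose N' : 'M[A]_n := \matrix_(j, l) N j l.
exists (char_poly N') => [|j jn]; first exact: char_poly_monic.
rewrite map_char_poly char_poly_horner; set T := a%:M - _.
pose v : 'cV[C]_n := \col_j t j.
have Qv k : Q ((T *m v) k 0).
  rewrite mulmxBl mul_scalar_mx !mxE; have := rel k (ltn_ord k).
  by congr (Q (_ - _)); apply: eq_bigr => l _; rewrite !mxE.
have := congr1 (fun V : 'cV[C]_n => V (Ordinal jn) 0) (mulmxA (\adj T) T v).
rewrite mul_adj_mx mul_scalar_mx [RHS]mxE [v _ _]mxE /= => <-.
by rewrite mxE; apply: (ideal_sum hQ) => k _; exact: (ideal_mull hQ).
Qed.

(** Write the polynomial as [q X + c]. Then [c] lies in [Q'], hence in [Q], so [q(a) a] is in [Q];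
    by primality either [a] is, or the degree can be lowered. *)
Lemma integral_incomparable (A C : comNzRingType) (i : {rmorphism A -> C})
    (Q Q' : set C) a (p : {poly A}) :
  prime_ideal Q -> is_ideal Q' -> Q `<=` Q' -> i @^-1` Q' `<=` i @^-1` Q ->
  p \is monic -> Q (map_poly i p).[a] -> Q' a -> Q a.
Proof.
move=> [hQ Q1 Qp] hQ' QQ' sub mp Qpa Q'a; elim/poly_ind: p mp Qpa => [|p c IH].
  by rewrite monicE lead_coef0 eq_sym oner_eq0.
have [->|p0] := eqVneq p 0.
  rewrite mul0r add0r monicE lead_coefC => /eqP->.
  by rewrite map_polyC hornerC /= rmorph1.
rewrite monicE lead_coefDl ?lead_coefMX => [mp|]; last first.
  rewrite size_polyC size_mulX // ltnS (leq_trans (leq_b1 _)) //.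
  by rewrite lt0n size_poly_eq0.
rewrite rmorphD rmorphM /= map_polyX map_polyC !hornerE => Qpa.
have Qc : Q (i c).
  apply: sub; rewrite /preimage /= -(addKr ((map_poly i p).[a] * a) (i c)) addrC.
  exact: idealB hQ' (QQ' _ Qpa) (ideal_mull hQ' Q'a).
move/(idealB hQ)/(_ Qc): Qpa; rewrite addrK => /Qp[|//].
by apply: IH; rewrite monicE.
Qed.

Section Weierstrass.
Variables (B S : comNzRingType) (M : set B) (D : B -> B) (x : B).
Variables (i : {rmorphism S -> B}) (e : {rmorphism B -> S}).
Hypotheses (gB : good M) (derD : der D) (Mx : M x) (Dx : D x = 1).
Hypotheses (Di : forall s, D (i s) = 0) (ei : forall s, e (i s) = s).
Hypotheses (ex : e x = 0) (ie : forall a, exists c, a = i (e a) + x * c).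

Local Notation MS := (i @^-1` M).

Definition xpoly n (s : nat -> S) : B := \sum_(k < n) i (s k) * x ^+ k.

Lemma slice_expand n g : exists s h, g = xpoly n s + x ^+ n * h.
Proof.
elim: n => [|n [s [h gE]]].
  by exists (fun=> 0), g; rewrite /xpoly big_ord0 add0r mul1r.
have [c hE] := ie h.
exists (fun k => if (k < n)%N then s k else e h), c.
rewrite gE {1}hE /xpoly big_ord_recr /= ltnn exprSr.
under [in RHS]eq_bigr => k _ do rewrite ltn_ord.
ring.
Qed.

(** Coefficients in [x] are peeled off while they lie in the maximal ideal of [S]. If the first
    [d.+1] all did, [D^d] would send both the polynomial part and the multiple of [x ^+ d.+1] into
    [M]. *)
Lemma slice_weierstrass_form f d : ~ M (iter d D f) -> exists n s u,
  [/\ forall k, MS (s k), ~ M u & f = xpoly n s + x ^+ n * u].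
Proof.
move=> Mdf; apply: contrapT => no; apply: Mdf; have hM := good_ideal gB.
have [s [u [Ms fE]]] : exists s u, (forall k, MS (s k)) /\
    f = xpoly d.+1 s + x ^+ d.+1 * u.
  elim: d.+1 => [|n [s [h [Ms fE]]]].
    exists (fun=> 0), f; rewrite /xpoly big_ord0 add0r mul1r; split=> // _.
    by rewrite /preimage /= rmorph0; exact: ideal0 hM.
  have Mh : M h by apply: contrapT => Mh; apply: no; exists n, s, h.
  have [c hE] := ie h.
  exists (fun k => if (k < n)%N then s k else e h), c; split=> [k|].
    by case: ifP => // _; apply: (slice_mem gB Mx ie h).1.
  rewrite fE {1}hE /xpoly big_ord_recr /= ltnn exprSr.
  under [in RHS]eq_bigr => k _ do rewrite ltn_ord.
  ring.
have iterD k a b : iter k D (a + b) = iter k D a + iter k D b.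
  by elim: k => //= k ->; exact: derD.1.
have iterM k t a : iter k D (i t * a) = i t * iter k D a.
  by elim: k => //= k ->; rewrite derD.2 Di mulr0 addr0.
rewrite fE iterD; apply: (idealD hM).
  rewrite /xpoly; elim/big_ind: _ => [|a b Ma Mb|k _].
  - rewrite (_ : iter d D 0 = 0); first exact: ideal0 hM.
    by elim: d {s u Ms fE} => //= k ->; exact: der0.
  - by rewrite iterD; exact: (idealD hM).
  - by rewrite iterM; exact: ideal_mulr hM (Ms k).
have drop k a : mpow M k.+1 a -> mpow M 1 (iter k D a).
  by elim: k a => // k IH a Ma; rewrite iterSr; apply: IH; exact: der_mpow.
rewrite -(mpow1 hM); apply: drop; rewrite mulrC; apply: mpowMl.
exact: mpow_exp.
Qed.

(* The extension of the k-th power of the maximal ideal of S. *)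
Definition coef_ideal k : set B := ideal_gen (i @` mpow MS k).

Lemma coef_idealM k t z :
  mpow MS k t -> coef_ideal 1 z -> coef_ideal k.+1 (i t * z).
Proof.
move=> Mt; move: z; have hI := ideal_gen_ideal (i @` mpow MS k.+1).
rewrite /coef_ideal (mpow1 (preimage_ideal i (good_ideal gB))).
rewrite -/(_ `<=` [set z | coef_ideal k.+1 (i t * z)]).
apply: ideal_gen_min => [|_ [c Mc <-] /=].
  split=> [|a b ha hb|a b hb] /=.
  - by rewrite mulr0; exact: ideal0 hI.
  - by rewrite mulrDr; exact: (idealD hI).
  - by rewrite mulrCA; exact: (ideal_mull hI).
by apply: sub_ideal_gen; exists (c * t); [exact: mpowS|rewrite rmorphM mulrC].
Qed.

Lemma coef_ideal_sub k : coef_ideal k `<=` mpow M k.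
Proof.
apply: ideal_gen_min => [|_ [c Mc <-]]; first exact: mpow_ideal.
exact: slice_mpow_i.
Qed.

Lemma xpoly_sub n (s t : nat -> S) :
  xpoly n (fun k => s k - t k) = xpoly n s - xpoly n t.
Proof.
by rewrite /xpoly -sumrB; apply: eq_bigr => k _; rewrite rmorphB mulrBl.
Qed.

Section Division.
Variables (n : nat) (s : nat -> S) (u f : B).
Hypotheses (Ms : forall k, MS (s k)) (Mu : ~ M u).
Hypothesis fE : f = xpoly n s + x ^+ n * u.

(** With [h] the part of [g] beyond [x ^+ n] and [v] the inverse of [u], the quotient [v * h]
    cancels [x ^+ n * h]; the error is a multiple of [xpoly n s]. *)
Lemma weierstrass_step g : exists t q, coef_ideal 1 (g - (xpoly n t + f * q)).
Proof.
have [v uv] := good_unit gB Mu; have [t [h gE]] := slice_expand n g.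
exists t, (v * h); rewrite {1}gE.
rewrite (_ : _ - _ = - (v * h) * xpoly n s).
  apply: ideal_mull (ideal_gen_ideal _) _; apply: ideal_sum (ideal_gen_ideal _) _.
  move=> k _; apply: ideal_mulr (ideal_gen_ideal _) _; apply: sub_ideal_gen.
  by exists (s k) => //; rewrite (mpow1 (preimage_ideal i (good_ideal gB))).
have -> : x ^+ n * h = x ^+ n * (u * v) * h by rewrite uv mulr1.
by rewrite fE; ring.
Qed.

Lemma weierstrass_step_pow k g : coef_ideal k g -> exists t q,
  [/\ forall j, mpow MS k (t j), mpow M k q &
      coef_ideal k.+1 (g - (xpoly n t + f * q))].
Proof.
have hI := ideal_gen_ideal (i @` mpow MS k.+1).
pose W := [set g | exists t q, [/\ forall j, mpow MS k (t j), mpow M k q &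
      coef_ideal k.+1 (g - (xpoly n t + f * q))]].
(* Quantifying over all multiples of [g] makes the property one that defines an ideal. *)
suff: coef_ideal k `<=` [set g | forall b, W (g * b)].
  by move=> /(_ g) h /h/(_ 1); rewrite mulr1.
apply: ideal_gen_min => [|_ [c Mc <-] b /=].
  split=> [b|a a' ha ha' b|a a' ha' b] /=.
  - exists (fun=> 0), 0; split=> [_||]; [exact: mpow0|exact: mpow0|].
    rewrite mul0r mulr0 addr0 /xpoly big1 ?subrr; first exact: ideal0 hI.
    by move=> j _; rewrite rmorph0 mul0r.
  - have [t [q [Mt Mq h]]] := ha b; have [t' [q' [Mt' Mq' h']]] := ha' b.
    (* The double negation brings the sum into the form of [xpoly_sub]. *)
    exists (fun j => t j - - t' j), (q + q'); split=> [j||].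
    + by rewrite opprK; exact: mpowD.
    + exact: mpowD.
    + rewrite xpoly_sub (_ : xpoly n (fun j => - t' j) = - xpoly n t').
        rewrite (_ : _ - _ = (a * b - (xpoly n t + f * q)) +
          (a' * b - (xpoly n t' + f * q'))); last ring.
        exact: (idealD hI).
      by rewrite /xpoly -sumrN; apply: eq_bigr => j _; rewrite rmorphN mulNr.
  - by rewrite (_ : a * a' * b = a' * (a * b)); [exact: ha'|ring].
have [t [q h]] := weierstrass_step b.
exists (fun j => c * t j), (i c * q); split=> [j||].
- by rewrite mulrC; exact: mpowMl.
- by rewrite mulrC; apply: mpowMl; exact: slice_mpow_i.
rewrite (_ : xpoly n (fun j => c * t j) = i c * xpoly n t); last first.
  by rewrite /xpoly mulr_sumr; apply: eq_bigr => j _; rewrite rmorphM mulrA.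
rewrite (_ : _ - _ = i c * (b - (xpoly n t + f * q))); last ring.
exact: coef_idealM.
Qed.

(** Iterating the approximate division drives the remainder to 0, while the coefficients converge in
    [S] and the quotients in [B]. *)
Lemma weierstrass_division g : exists t q, g = xpoly n t + f * q.
Proof.
have /choice[F FP] : forall kg : nat * B, exists tq : (nat -> S) * B,
    coef_ideal kg.1 kg.2 -> [/\ forall j, mpow MS kg.1 (tq.1 j),
      mpow M kg.1 tq.2 &
      coef_ideal kg.1.+1 (kg.2 - (xpoly n tq.1 + f * tq.2))].
  move=> [k h]; have [/weierstrass_step_pow[t [q tq]]|nh] := pselect (coef_ideal k h).
    by exists (t, q).
  by exists (fun=> 0, 0) => /nh.
have [G [G0 GS]] : exists G : nat -> B, G 0%N = g /\
    forall k, G k.+1 = G k - (xpoly n (F (k, G k)).1 + f * (F (k, G k)).2).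
  by exists (fix G k := if k is k'.+1 then
    G k' - (xpoly n (F (k', G k')).1 + f * (F (k', G k')).2) else g).
have GI k : coef_ideal k (G k).
  elim: k => [|k IH]; last by rewrite GS; have [] := FP (k, G k) IH.
  rewrite -(mulr1 (G _)); apply: ideal_mull (ideal_gen_ideal _) _.
  by apply: sub_ideal_gen; exists 1; rewrite ?rmorph1.
pose T j k := \sum_(l < k) (F (l : nat, G l)).1 j.
pose Q k := \sum_(l < k) (F (l : nat, G l)).2.
have gE k : g = xpoly n (T ^~ k) + f * Q k + G k.
  elim: k => [|k IH].
    rewrite G0 /Q big_ord0 mulr0 addr0 /xpoly big1 ?add0r // => j _.
    by rewrite /T big_ord0 rmorph0 mul0r.
  rewrite {1}IH GS /Q [in RHS]big_ord_recr /=.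
  have -> : xpoly n (T ^~ k.+1) = xpoly n (T ^~ k) + xpoly n (F (k, G k)).1.
    rewrite /xpoly -big_split; apply: eq_bigr => j _ /=.
    by rewrite /T big_ord_recr rmorphD mulrDl.
  ring.
have gS := slice_good gB derD Mx Dx Di ei ex ie.
have /choice[t tP] : forall j, exists t, forall k, mpow MS k (t - T j k).
  move=> j; apply: (good_lim gS) => k.
  rewrite (_ : _ - _ = (F (k, G k)).1 j); last by rewrite /T big_ord_recr /=; ring.
  by have [] := FP (k, G k) (GI k).
have [k|q qP] := good_lim gB (u := Q).
  rewrite (_ : _ - _ = (F (k, G k)).2); last by rewrite /Q big_ord_recr /=; ring.
  by have [] := FP (k, G k) (GI k).
exists t, q; apply/eqP; rewrite -subr_eq0; apply/eqP/(good_sep gB) => k.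
rewrite {1}(gE k) (_ : _ - _ = G k - xpoly n (fun j => t j - T j k) - f * (q - Q k)).
  apply: idealB (mpow_ideal _ _) _ _; last exact: mpowMl.
  apply: idealB (mpow_ideal _ _) (coef_ideal_sub (GI k)) _.
  apply: ideal_sum (mpow_ideal _ _) _ => j _; rewrite mulrC; apply: mpowMl.
  exact: slice_mpow_i.
by rewrite xpoly_sub; ring.
Qed.

End Division.

(** Division by [f], which lies in [Q], shows that finitely many powers of [x] span [B] modulo [Q]
    over [S]. So every element of [Q'] is integral over [S] modulo [Q]. *)
Lemma slice_incomparable f d (Q Q' : set B) : M f -> ~ M (iter d D f) -> Q f ->
  prime_ideal Q -> is_ideal Q' -> Q `<=` Q' -> i @^-1` Q' `<=` i @^-1` Q ->
  Q' `<=` Q.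
Proof.
move=> Mf Mdf Qf hQ hQ' QQ' sub a Q'a; have [hQi Q1 Qp] := hQ.
(* Degree 0 would give [f = u], outside [M]; so the degree is positive and [1] is among the spanning
   powers of [x]. *)
have [[|n] [s [u [Ms Mu fE]]]] := slice_weierstrass_form Mdf.
  by case: Mu; move: Mf; rewrite fE /xpoly big_ord0 add0r mul1r.
have /choice[N NP] : forall j, exists t : nat -> S,
    Q (a * x ^+ j - xpoly n.+1 t).
  move=> j; have [t [q ->]] := weierstrass_division Ms Mu fE (a * x ^+ j).
  by exists t; rewrite addrC addKr; exact: ideal_mulr hQi Qf.
have [|p mp pa] := @integral_of_relations _ _ i Q n.+1 (fun j => x ^+ j) N a hQi.
  by move=> j _; exact: NP.
apply: (integral_incomparable hQ hQ' QQ' sub mp _ Q'a).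
by have := pa 0%N isT; rewrite mulr1.
Qed.

End Weierstrass.

(** An [f] in the second prime but not in the first lies in all later ones. These contract to a
    strict chain in the ring of constants, one step shorter, whose maximal ideal has one generator
    fewer. *)
Lemma good_chain_le (B : comNzRingType) (M : set B) (r : seq B) n :
  good M -> M = ideal_gen [set` r] -> prime_chain B n -> (n <= size r)%N.
Proof.
elim: n B M r => // n IH B M r gB Mr /prime_chainP[P [Pp Plt]].
have [f Pf [P0f f0]] : exists2 f, P 1%N f & ~ P 0%N f /\ f <> 0.
  have [_ nP] := Plt 0%N isT; apply: contrapT => no; apply: nP => f P1f.
  apply: contrapT => P0f; apply: no; exists f => //; split=> // f0.
  by apply: P0f; rewrite f0; have [/ideal0] := Pp 0%N isT.
have Mf : M f by have [hP P1 _] := Pp 1%N isT; exact: (good_sub_max gB hP P1).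
have [x [D [d [xr derD Dx Mdf]]]] := good_adapted_derivation gB Mr Mf f0.
have Mx : M x by rewrite Mr; exact: sub_ideal_gen.
have [S [i [e [Di ei ex ie]]]] := slice_retract gB derD Mx Dx.
have gS := slice_good gB derD Mx Dx Di ei ex ie.
have MSr := slice_gen gB Mx ei ex ie xr Mr.
have Pmono j : (0 < j <= n.+1)%N -> P j f.
  elim: j => [//|[//|j] IHj] /= jn; have [sub _] := Plt j.+1 jn.
  by apply: sub; apply: IHj; exact: ltnW.
have : (n <= size (map e (rem x r)))%N.
  apply: (IH _ _ _ gS MSr); apply/prime_chainP.
  exists (fun j => i @^-1` P j.+1); split=> j jn.
    have [hP P1 PM] := Pp j.+1 jn; split; first exact: preimage_ideal.
      by rewrite /preimage /= rmorph1.
    by move=> a b; rewrite /preimage /= rmorphM; exact: PM.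
  have [sub nsub] := Plt j.+1 jn; split=> [a|h]; first exact: sub.
  apply: nsub; have [hP' _ _] := Pp j.+2 jn.
  apply: (slice_incomparable gB derD Mx Dx Di ei ex ie Mf Mdf) h => //.
    by apply: Pmono; rewrite /= ltnW.
  by apply: Pp; exact: ltnW.
by rewrite size_map size_rem //; case: (r) xr.
Qed.

Lemma good_regular (B : comNzRingType) (M : set B) (r : seq B) :
  good M -> M = ideal_gen [set` r] -> regular_local_ring B.
Proof.
move=> gB Mr; have [nB _ [s [Ms chB]]] := good_structure gB Mr.
split=> //; exists M.
  by split; [exact: good_maximal|exact: good_max_uniq].
exists (size s); last by exists (in_tuple s).
by split=> // n; apply: (good_chain_le gB Ms).
Qed.

(** * Stalks, completions and the formal leaf *)

Definition nonzero_ring (B : comPzRingType) of 1 != 0 :> B : Type := B.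
HB.instance Definition _ (B : comPzRingType) (nz : 1 != 0 :> B) :=
  GRing.ComPzRing.copy (nonzero_ring nz) B.
HB.instance Definition _ (B : comPzRingType) (nz : 1 != 0 :> B) :=
  GRing.PzSemiRing_isNonZero.Build (nonzero_ring nz) nz.

(** An equality of rings, unlike an isomorphism, transports ideals, generators and regularity all at
    once. *)
Lemma nonzero_ringE (B : comPzRingType) (nz : 1 != 0 :> B) :
  (nonzero_ring nz : comNzRingType) = B :> comPzRingType.
Proof. by case: B nz => T []. Qed.

Lemma good_regular_pz (B : comPzRingType) (M : set B) (r : seq B) :
  good M -> M = ideal_gen [set` r] -> regular_local_ring B.
Proof.
move=> gB; have nz : (1 : B) != 0.
  apply/eqP => B1; apply: (good_proper gB); rewrite B1.
  exact: ideal0 (good_ideal gB).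
by case: _ / (nonzero_ringE nz) M r gB => M r; exact: good_regular.
Qed.

Section StalkIdeal.
Variables (X : ringed_space) (x : X) (Ox : stalk x) (U : opens X) (Ux : oset U x).
Variables (R : comPzRingType) (ch : affine_chart U R).

Let phi (a : R) : Ox := germ Ox Ux (chart_map ch a).

Lemma chart_basic_open (a : R) : ~ chart_prime ch x a ->
  exists V : opens X, [/\ V `<=` U, oset V x &
    oset V = [set z | oset U z /\ ~ chart_prime ch z a]].
Proof.
move=> Pa; pose W := [set z | oset U z /\ ~ chart_prime ch z a].
have WU : W `<=` U by move=> z [].
have oW : open W.
  apply/(chart_top ch WU); exists [set a].
  apply/seteqP; split=> [z [Uz az]|z [Uz [_ -> az]]]; split=> //.
  by exists a.
by exists (Opens oW).
Qed.

Lemma stalk_unit a : ~ chart_prime ch x a -> exists c, phi a * c = 1.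
Proof.
move=> Pa; have [V [VU Vx VE]] := chart_basic_open Pa.
have [[c ac] _ _] := chart_sec VU VE; exists (germ Ox Vx c).
by rewrite /phi -(germ_res Ox VU Ux Vx) -rmorphM ac rmorph1.
Qed.

(** A germ is defined on a basic open neighbourhood of [x] inside the chart, where sections are
    fractions. *)
Lemma stalk_fraction y : exists a n b,
  ~ chart_prime ch x a /\ y * phi a ^+ n = phi b.
Proof.
have [V [Vx [s <-]]] := germ_surj y.
pose W := [set z | oset U z /\ oset V z].
have WU : W `<=` U by move=> z [].
have oW : open W by apply: openI; exact: oset_open.
have /(chart_top ch WU)[T WE] := oW.
have [_ [a Ta Pa]] : [set z | oset U z /\ exists2 a, T a & ~ chart_prime ch z a] x.
  by rewrite -WE.
have [V' [V'U V'x V'E]] := chart_basic_open Pa.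
have V'V : V' `<=` V.
  move=> z; rewrite V'E => -[Uz za].
  have : W z by rewrite WE; split=> //; exists a.
  by case.
have [_ frac _] := chart_sec V'U V'E.
have [n [b sb]] := frac (res V'V s).
exists a, n, b; split=> //.
rewrite /phi -(germ_res Ox V'U Ux V'x) -(germ_res Ox V'V Vx V'x) -rmorphXn -rmorphM.
by rewrite sb germ_res.
Qed.

(** Generators of the contraction of [m] to [R] also generate [m], because the denominators are
    units in the stalk. *)
Lemma stalk_ideal_fg (m : set Ox) : noetherian R -> is_ideal m ->
  exists s : seq Ox, m = ideal_gen [set` s].
Proof.
move=> nR hm.
have [|t tE] := nR [set a | m (phi a)].
  rewrite /phi; split=> [|a b /= ha hb|a b /= hb].
  - by rewrite /= !rmorph0; exact: ideal0 hm.
  - by rewrite !rmorphD; exact: (idealD hm).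
  - by rewrite !rmorphM; exact: (ideal_mull hm).
exists (map phi t); apply/seteqP; split=> [y my|]; last first.
  apply: ideal_gen_min => // _ /mapP[a ta ->].
  have : ideal_gen [set` t] a by exact: sub_ideal_gen.
  by rewrite -tE.
have [a [n [b [Pa yb]]]] := stalk_fraction y.
have [c ac] := stalk_unit Pa.
have : [set a | m (phi a)] b by rewrite /= -yb; exact: ideal_mulr hm my.
rewrite tE lcombP => -[d _ bE].
have -> : y = c ^+ n * phi b.
  by rewrite -yb mulrCA -exprMn [c * _]mulrC ac expr1n mulr1.
apply: ideal_mull (ideal_gen_ideal _) _; rewrite -bE /phi.
by rewrite !image_lcomb -map_comp; exact: lcomb_gen.
Qed.

End StalkIdeal.

(** * The completion at a finitely generated maximal ideal *)

Section CompletionTheory.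
Variables (A : comPzRingType) (m : set A) (Ah : completion m) (r : seq A).
Hypotheses (m_max : maximal_ideal m) (mr : m = ideal_gen [set` r]).

Local Notation C := (cpl_ker Ah).
Local Notation phi := (cpl_map Ah).

Let hm : is_ideal m. Proof. by case: m_max. Qed.
Let mem_m a : a \in r -> m a.
Proof.
by move=> ar; have : ideal_gen [set` r] a; [exact: sub_ideal_gen|rewrite -mr].
Qed.
Let hC n : is_ideal (C n). Proof. exact: cpl_ker_ideal. Qed.

Lemma cpl_kerP n a : C n (phi a) <-> mpow m n a.
Proof. by rewrite -(ideal_powE n hm); exact: cpl_kerE. Qed.

Lemma cpl_le n p : (n <= p)%N -> C p `<=` C n.
Proof.
move/subnK <-; elim: (p - n)%N => // k IH; rewrite addSn.
by apply: subset_trans IH; exact: cpl_decr.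
Qed.

Lemma cpl_ker0 b : C 0 b.
Proof.
have [a ba] := cpl_dense 0 b; rewrite -(subrK (phi a) b).
by apply: (idealD (hC 0)) => //; apply/cpl_kerP.
Qed.

Lemma cpl_approx n b : exists a, C n (b - phi a) /\
  forall k, (k <= n)%N -> C k b -> mpow m k a.
Proof.
have [a ba] := cpl_dense n b; exists a; split=> // k kn Cb.
by apply/cpl_kerP/(ideal_subl (hC k) (cpl_le kn ba)).
Qed.

Lemma cpl_ker_mul n p a b : C n a -> C p b -> C (n + p) (a * b).
Proof.
move=> Ca Cb.
have [a' [aa' /(_ n (leq_addr _ _) Ca) ma']] := cpl_approx (n + p) a.
have [b' [bb' /(_ p (leq_addl _ _) Cb) mb']] := cpl_approx (n + p) b.
rewrite (_ : a * b = (a - phi a') * b + phi a' * (b - phi b') + phi (a' * b')).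
  apply: (idealD (hC _)); last by apply/cpl_kerP; exact: mpow_mul.
  apply: (idealD (hC _)); first exact: ideal_mulr (hC _) aa'.
  exact: ideal_mull (hC _) bb'.
by rewrite rmorphM; ring.
Qed.

(** [cpl_lim] concerns sequences from [A], so each [v n] is first replaced by an element of [A]
    congruent to it modulo [C n]. *)
Lemma cpl_cauchy (v : nat -> Ah) : (forall n, C n (v n.+1 - v n)) ->
  exists b, forall n, C n (b - v n).
Proof.
move=> vP.
have /choice[u uP] : forall n, exists a, C n (v n - phi a).
  by move=> n; exact: cpl_dense.
have [n|b bP] := cpl_lim Ah (u := u).
  rewrite ideal_powE //; apply/cpl_kerP; rewrite rmorphB.
  apply: (ideal_trans (hC n) (b := v n)) => //.
  apply: (ideal_trans (hC n) (b := v n.+1)) => //.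
  by apply: (ideal_swap (hC n)); exact: cpl_decr.
exists b => n; apply: (ideal_trans (hC n) (bP n)).
exact: ideal_swap (hC n) (uP n).
Qed.

(** Successive approximation: a remainder in [C (n + k).+1] agrees to the next order with a
    combination of [r] whose coefficients lie in the power [n + k] of [m]. Their sums converge and
    stay in [C n]. *)
Lemma cpl_ker_gen n b : C n.+1 b ->
  exists2 c : nat -> Ah, (forall j, C n (c j)) & b = lcomb (map phi r) c.
Proof.
move=> Cb.
have /choice[F FP] : forall ka : nat * Ah, exists c : nat -> A, C ka.1.+1 ka.2 ->
    (forall j, mpow m ka.1 (c j)) /\
    C ka.1.+2 (ka.2 - lcomb (map phi r) (phi \o c)).
  move=> [k a] /=; have [Ca|nC] := pselect (C k.+1 a); last by exists (fun=> 0).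
  have [a' [aa' /(_ k.+1 (leqnSn _) Ca) ma']] := cpl_approx k.+2 a.
  have [c mc a'E] := mpowS_gen mr ma'; exists c => _; split=> //.
  by rewrite -image_lcomb -a'E.
have [G [G0 GS]] : exists G : nat -> Ah, G 0%N = b /\ forall k,
    G k.+1 = G k - lcomb (map phi r) (phi \o F ((n + k)%N, G k)).
  by exists (fix G k := if k is k'.+1 then
    G k' - lcomb (map phi r) (phi \o F ((n + k')%N, G k')) else b).
have GC k : C (n + k).+1 (G k).
  elim: k => [|k IH]; first by rewrite G0 addn0.
  by rewrite GS addnS; have [] := FP ((n + k)%N, G k) IH.
have Fm k j : mpow m (n + k) (F ((n + k)%N, G k) j).
  by have [] := FP ((n + k)%N, G k) (GC k).
pose u j k := \sum_(l < k) phi (F ((n + l)%N, G l) j).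
have uS j k : u j k.+1 = u j k + phi (F ((n + k)%N, G k) j).
  by rewrite /u big_ord_recr.
have bE k : b = lcomb (map phi r) (u ^~ k) + G k.
  elim: k => [|k IH].
    by rewrite G0 /lcomb big1 ?add0r // => j _; rewrite /u big_ord0 mul0r.
  pose L := lcomb (map phi r) (phi \o F ((n + k)%N, G k)).
  rewrite {1}IH GS -/L.
  have -> : lcomb (map phi r) (u ^~ k.+1) = lcomb (map phi r) (u ^~ k) + L.
    rewrite /L /lcomb -big_split; apply: eq_bigr => j _ /=.
    by rewrite uS mulrDl.
  ring.
have /choice[c cP] : forall j, exists c, forall k, C k (c - u j k).
  move=> j; apply: cpl_cauchy => k.
  rewrite (_ : _ - _ = phi (F ((n + k)%N, G k) j)); last by rewrite uS; ring.
  by apply: (cpl_le (leq_addl n k)); apply/cpl_kerP.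
exists c => [j|].
  have Cu k : C n (u j k).
    apply: (ideal_sum (hC n)) => l _.
    by apply: (cpl_le (leq_addr l n)); apply/cpl_kerP.
  exact: (ideal_subl (hC n) (cP j n)).2.
apply/eqP; rewrite -subr_eq0; apply/eqP/(cpl_sep (c := Ah)) => k.
rewrite {1}(bE k) (_ : _ - _ = G k - lcomb (map phi r) (fun j => c j - u j k)).
  apply: (idealB (hC k)).
    by apply: cpl_le (GC k); rewrite leqW // leq_addl.
  apply: (ideal_sum (hC k)) => j _; exact: ideal_mulr (hC k) (cP j k).
have -> : lcomb (map phi r) (fun j => c j - u j k) =
    lcomb (map phi r) c - lcomb (map phi r) (u ^~ k).
  by rewrite /lcomb -sumrB; apply: eq_bigr => j _; rewrite mulrBl.
ring.
Qed.

(** By finite generation the limit topology is the adic topology of [C 1]. *)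
Lemma cpl_ker_mpow n : C n = mpow (C 1) n.
Proof.
elim: n => [|n IH]; first by apply/seteqP; split=> // b _; exact: cpl_ker0.
apply/seteqP; split=> [b /cpl_ker_gen[c cC ->]|]; last first.
  apply: mpowS_min => // a b Ca; rewrite -IH => Cb.
  exact: (@cpl_ker_mul 1).
apply: ideal_sum (mpow_ideal _ _) _ => j _; rewrite mulrC; apply: mpowS.
  rewrite (nth_map 0); last by rewrite -(size_map phi).
  by apply/cpl_kerP; rewrite mpow1 //; apply/mem_m/mem_nth; rewrite -(size_map phi).
by rewrite -IH.
Qed.

Lemma cpl_ker1_gen : C 1 = ideal_gen [set` map phi r].
Proof.
apply/seteqP; split=> [b /cpl_ker_gen[c _ ->]|]; first exact: lcomb_gen.
apply: ideal_gen_min => // _ /mapP[a ar ->].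
by apply/cpl_kerP; rewrite mpow1 //; exact: mem_m.
Qed.

Lemma cpl_ker1_proper : ~ C 1 1.
Proof.
by rewrite -(rmorph1 phi) => /cpl_kerP; rewrite mpow1 //; case: m_max.
Qed.

(** Maximality of [m] gives an inverse of [b] modulo [C 1], and a geometric series corrects it. *)
Lemma cpl_unit b : ~ C 1 b -> exists c, b * c = 1.
Proof.
move=> Cb; have [a ba] := cpl_dense 1 b.
have ma : ~ m a.
  by move=> ma; apply: Cb; apply/(ideal_subl (hC 1) ba)/cpl_kerP; rewrite mpow1.
pose J := [set y | exists c, m (y - a * c)].
have hJ : is_ideal J.
  split=> [|y z [c mc] [d md]|y z [c mc]].
  - by exists 0; rewrite mulr0 subrr; exact: ideal0 hm.
  - exists (c + d); rewrite (_ : _ - _ = (y - a * c) + (z - a * d)); last ring.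
    exact: (idealD hm).
  - exists (y * c); rewrite (_ : _ - _ = y * (z - a * c)); last ring.
    exact: (ideal_mull hm).
have [a' ma'] : J 1.
  have [_ _ /(_ J hJ)[y my||->//]] := m_max.
    by exists 0; rewrite mulr0 subr0.
  move=> Jm; case: ma; rewrite -Jm; exists 1; rewrite mulr1 subrr.
  exact: ideal0 hm.
pose d := 1 - b * phi a'.
have Cd : C 1 d.
  rewrite /d (_ : _ - _ = phi (1 - a * a') - (b - phi a) * phi a').
    apply: (idealB (hC 1)); last exact: ideal_mulr (hC 1) ba.
    by apply/cpl_kerP; rewrite mpow1.
  by rewrite rmorphB rmorphM rmorph1; ring.
have Cdn n : C n (d ^+ n) by rewrite cpl_ker_mpow; exact: mpow_exp.
have [n|w wP] := @cpl_cauchy (fun n => \sum_(k < n) d ^+ k).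
  by rewrite (_ : _ - _ = d ^+ n) // big_ord_recr /=; ring.
exists (phi a' * w); apply/eqP; rewrite -subr_eq0; apply/eqP/(cpl_sep (c := Ah)) => n.
have geom : (1 - d) * \sum_(k < n) d ^+ k = 1 - d ^+ n.
  by rewrite -opprB mulNr -subrX1 opprB.
rewrite (_ : _ - _ = (1 - d) * (w - \sum_(k < n) d ^+ k) - d ^+ n).
  by apply: (idealB (hC n)) => //; exact: ideal_mull (hC n) (wP n).
by rewrite mulrBr geom /d; ring.
Qed.

Lemma cpl_maximal mh : maximal_ideal mh -> mh = C 1.
Proof.
move=> [hmh mh1 /(_ (C 1) (hC 1))[a mha|//|CT]].
  apply: contrapT => /cpl_unit[c ac]; apply: mh1; rewrite -ac.
  exact: ideal_mulr hmh mha.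
by case: cpl_ker1_proper; rewrite CT.
Qed.

(** * The quotient by the largest invariant ideal *)

Section LeafQuotient.
Variables (Ds : set (Ah -> Ah)) (K : set Ah) (B : quotient K).
Hypothesis Ds_der : forall d, Ds d -> der d.
Hypothesis Ds_cont : forall d, Ds d ->
  forall n, exists N, d @` C N `<=` C n.
Hypothesis hK : is_ideal K.
Hypothesis K_inv : forall d, Ds d -> d @` K `<=` K.
Hypothesis K_sub : K `<=` C 1.
Hypothesis K_max : forall J, is_ideal J -> (forall d, Ds d -> d @` J `<=` J) ->
  J `<=` C 1 -> J `<=` K.
Hypothesis Ah_nat : forall n, exists c : Ah, n.+1%:R * c = 1.

Local Notation p := (quot_map B).

Lemma quot_eq a b : p a = p b <-> K (a - b).
Proof.
rewrite -(quot_ker B) rmorphB; split=> [->|/eqP]; first by rewrite subrr.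
by rewrite subr_eq0 => /eqP.
Qed.

(* The closure of K is again invariant because the derivations are continuous. *)
Lemma leaf_closed b : (forall n, exists2 c, K c & C n (b - c)) -> K b.
Proof.
apply: (K_max (J := [set b | forall n, exists2 c, K c & C n (b - c)])).
- split=> [n|a a' ha ha' n|a a' ha' n].
  + by exists 0; rewrite ?subr0; [exact: ideal0 hK|exact: ideal0 (hC n)].
  + have [c Kc ac] := ha n; have [c' Kc' ac'] := ha' n.
    exists (c + c'); first exact: (idealD hK).
    by rewrite (_ : _ - _ = (a - c) + (a' - c')); [exact: (idealD (hC n))|ring].
  + have [c Kc ac] := ha' n; exists (a * c); first exact: (ideal_mull hK).
    by rewrite -mulrBr; exact: (ideal_mull (hC n)).
- move=> d Dd _ [a ha <-] n; have [N dN] := Ds_cont Dd n.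
  have [c Kc ac] := ha N; exists (d c); first by apply: (K_inv Dd); exists c.
  by rewrite -derB; [apply: dN; exists (a - c)|exact: Ds_der].
- move=> a /(_ 1%N)[c /K_sub Cc ac].
  by rewrite -(subrK c a); exact: (idealD (hC 1)).
Qed.

(** Separatedness is the closedness of [K], and simplicity its maximality: the preimage of a proper
    differential ideal is invariant, hence inside [K]. *)
Lemma leaf_quotient_good : good (p @` C 1).
Proof.
have p_surj := quot_surj (q := B).
have pC n : mpow (p @` C 1) n = p @` C n.
  by rewrite (image_mpow _ _ p_surj) -cpl_ker_mpow.
have pmem n a : (p @` C n) (p a) -> exists2 c, K c & C n (a - c).
  move=> [b Cb /quot_eq Kba]; exists (a - b); last by rewrite subKr.
  by apply: (ideal_swap hK).
have pC1 a : (p @` C 1) (p a) -> C 1 a.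
  by move=> /pmem[c /K_sub Cc ac]; rewrite -(subrK c a); exact: (idealD (hC 1)).
split.
- exact: (image_ideal p_surj (hC 1)).
- by rewrite -(rmorph1 p) => /pC1; exact: cpl_ker1_proper.
- move=> b; have [a <-] := p_surj b => pa.
  have [|c ac] := @cpl_unit a; first by move=> Ca; apply: pa; exists a.
  by exists (p c); rewrite -rmorphM ac rmorph1.
- move=> b; have [a <-] := p_surj b => pa; apply/quot_ker/leaf_closed => n.
  by apply: pmem; rewrite -pC.
- move=> u uP.
  (* Given a lift of [u n], [F] picks a lift of [u n.+1] congruent to it modulo [C n]; iteration
     yields a Cauchy sequence. *)
  have /choice[F FP] : forall na : nat * Ah, exists a',
      p na.2 = u na.1 -> p a' = u na.1.+1 /\ C na.1 (a' - na.2).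
    move=> [n a] /=; have [pa|npa] := pselect (p a = u n); last by exists 0.
    have := uP n; rewrite pC => -[c Cc pc]; exists (a + c) => _.
    by rewrite rmorphD pa pc addrC subrK addrC addKr.
  have [a0 pa0] := p_surj (u 0%N).
  pose v := fix v n := if n is n'.+1 then F (n', v n') else a0.
  have pv n : p (v n) = u n by elim: n => //= n IH; have [] := FP (n, v n) IH.
  have [n|b bP] := @cpl_cauchy v; first by have [] := FP (n, v n) (pv n).
  exists (p b) => n; rewrite -pv -rmorphB pC; by exists (b - v n).
- move=> n; have [c nc] := Ah_nat n; exists (p c).
  by rewrite -(rmorph_nat p) -rmorphM nc rmorph1.
- move=> I hI I1 inv b; have [a <-] := p_surj b => Ipa; apply/quot_ker.
  apply: (K_max (J := p @^-1` I)) => //; first exact: preimage_ideal.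
    move=> d Dd _ [c Ic <-]; have hd := Ds_der Dd.
    have /choice[g gP] : forall y, exists a, p a = y by [].
    (* Invariance of [K] makes [d] descend to the quotient through any section [g] of the
       projection. *)
    have dg a' : p (d (g (p a'))) = p (d a').
      apply/quot_eq; rewrite -derB //; apply: (K_inv Dd); exists (g (p a') - a') => //.
      by apply/quot_eq.
    rewrite /preimage /= -dg; apply: (inv (fun y => p (d (g y)))) => //.
    split=> y z; have [a1 <-] := p_surj y; have [a2 <-] := p_surj z.
      by rewrite -rmorphD !dg hd.1 rmorphD.
    by rewrite -rmorphM !dg hd.2 rmorphD !rmorphM.
  move=> c Ic; apply: contrapT => /cpl_unit[c' cc']; apply: I1.
  rewrite -(rmorph1 p) -cc' rmorphM; exact: ideal_mulr hI Ic.
Qed.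

Lemma leaf_quotient_regular : regular_local_ring B.
Proof.
apply: (good_regular_pz leaf_quotient_good (r := map p (map phi r))).
rewrite cpl_ker1_gen; apply: image_ideal_gen; exact: quot_surj.
Qed.

End LeafQuotient.

End CompletionTheory.

(* The stalk, its completion and the ring of the formal leaf enter through
   arbitrary models; [m] and [mh] name the maximal ideals of the first two. *)
Theorem corollary5p19 (k : fieldType) (char0 : [pchar k] =i pred0)
    (X : scheme_over k) (X_noeth : locally_noetherian X)
    (F : foliation X) (F_free : locally_free F)
    (x : X) (x_closed : closed [set x])
    (Ox : stalk x) (m : set Ox) (m_max : maximal_ideal m)
    (Ah : completion m) (mh : set Ah) (mh_max : maximal_ideal mh)
    (K : set Ah) (K_leaf : leaf_ideal F mh K)
    (B : quotient K) :
  regular_local_ring B.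
Proof.
have [U Ux [R nR [ch]]] := X_noeth x.
have [hm _ _] := m_max; have [r mr] := stalk_ideal_fg Ux ch nR hm.
have [[hK K_inv] K_sub K_max] := K_leaf.
rewrite (cpl_maximal m_max mr mh_max) in K_sub K_max.
apply: (leaf_quotient_regular m_max mr (Ds := extends_stalk F (Ah := Ah))) => //.
- by move=> d [[dD dM _] _ _].
- by move=> d [_ dC _].
- by move=> J hJ Jinv; apply: K_max.
(* Characteristic zero inverts [n.+1] in [k], and the structure map carries the inverse to the
   completion. *)
move=> n; have n0 : n.+1%:R != 0 :> k by rewrite ((pcharf0P k).1 char0).
pose c := @completed_const k X x Ox m Ah.
exists (c n.+1%:R^-1); rewrite -[n.+1%:R](_ : c n.+1%:R = _).
  by rewrite /c /completed_const -!rmorphM mulfV // !rmorph1.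
by rewrite /c /completed_const !rmorph_nat.
Qed.
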